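(* Let $M(\phi,\xi,\eta,g_M)$ be a cosymplectic manifold, $(N,g_N)$ a Riemannian manifold, and $F:M\to N$ a Riemannian submersion such that $(\ker F_* )^\perp=\phi(\ker F_* )\oplus\{\xi\}$. Then the $\phi$-sectional curvature $H$ of $M$ satisfies $$H(V)=g_M((\nabla_{\phi V}\mathcal T)(V,V),\phi V)-g_M(\mathcal T_VV,\mathcal T_VV),$$ $$H(X)=g_M((\nabla_X\mathcal T)(\phi X,\phi X),X)-g_M(\mathcal T_{\phi X}X,\mathcal T_{\phi X}X),$$ for any unit vertical vector $V$ and any unit horizontal vector $X$ orthogonal to $\xi$.
   Context: An almost contact metric structure $(\phi,\xi,\eta,g_M)$ on an odd-dimensional manifold $M$ consists of a $(1,1)$-tensor $\phi$, a vector field $\xi$, a $1$-form $\eta$ and a Riemannian metric $g_M$ with $\phi^2=-I+\eta\otimes\xi$, $\phi\xi=0$, $\eta\circ\phi=0$, $\eta(\xi)=1$, $g_M(\phi X,\phi Y)=g_M(X,Y)-\eta(X)\eta(Y)$, $\eta(X)=g_M(X,\xi)$. It is cosymplectic if it is normal and $\eta$ and $\Phi(X,Y)=g_M(X,\phi Y)$ are closed; the structure equation is $\nabla\phi=0$, and then $\nabla\xi=0$ ($\nabla$ the Levi-Civita connection of $g_M$). The $\phi$-sectional curvature is defined for unit vectors $E$ orthogonal to $\xi$ by $H(E)=g_M(R(E,\phi E)\phi E,E)$, where $R$ is the curvature tensor, with the sign convention that $g_M(R(X,Y)Y,X)$ is the sectional curvature for orthonormal $X,Y$. A Riemannian submersion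 $F:(M,g_M)\to(N,g_N)$ is a smooth surjective map of maximal rank such that $F_*$ preserves the lengths of horizontal vectors. Vertical means in $\ker F_*$, horizontal means in $(\ker F_* )^\perp$; $\mathcal V,\mathcal H$ are the corresponding orthogonal projections. O'Neill's tensor is the $(1,2)$-tensor $\mathcal T(E,G)=\mathcal T_EG=\mathcal H\nabla_{\mathcal VE}\mathcal VG+\mathcal V\nabla_{\mathcal VE}\mathcal HG$ on $M$, and $\nabla\mathcal T$ is its covariant derivative. Here $\{\xi\}$ denotes the line distribution spanned by $\xi$. *)

(* Defs.v *)
(* Smooth manifolds modelled on 'rV[R]_n, for R : realType *)
From HB Require Import structures.
From mathcomp Require Import all_boot all_order all_algebra.
From mathcomp Require Import all_classical all_reals all_analysis.

Set Implicit Arguments.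
Unset Strict Implicit.
Unset Printing Implicit Defensive.

Import Order.TTheory GRing.Theory Num.Theory.
Import numFieldNormedType.Exports.

Local Open Scope classical_set_scope.
Local Open Scope ring_scope.

(* Meant for open U only: f is k times continuously differentiable on U. *)
Fixpoint Ck {R : realType} {n : nat} {W : normedModType R} (k : nat)
    (U : set 'rV[R]_n) (f : 'rV[R]_n -> W) : Prop :=
  (forall x, U x -> {for x, continuous f}) /\
  match k with
  | 0 => True
  | k'.+1 => forall v : 'rV[R]_n,
      (forall x, U x -> derivable f x v) /\ Ck k' U ('D_v f)
  end.

Definition Cinfty {R : realType} {n : nat} {W : normedModType R}
    (U : set 'rV[R]_n) (f : 'rV[R]_n -> W) : Prop :=
  forall k, Ck k U f.

(* cmap and cinv are total functions, significant on cdom and ccod only. *)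
Record chart (R : realType) (n : nat) (M : topologicalType) := Chart {
  cdom : set M;
  ccod : set 'rV[R]_n;
  cmap :> M -> 'rV[R]_n;
  cinv : 'rV[R]_n -> M;
  cdom_open : open cdom;
  ccod_open : open ccod;
  cmap_cod : forall p, cdom p -> ccod (cmap p);
  cinv_dom : forall y, ccod y -> cdom (cinv y);
  cmapK : forall p, cdom p -> cinv (cmap p) = p;
  cinvK : forall y, ccod y -> cmap (cinv y) = y;
  cmap_continuous : forall p, cdom p -> {for p, continuous cmap};
  cinv_continuous : forall y, ccod y -> {for y, continuous cinv}
}.

Record manifold (R : realType) (n : nat) := Manifold {
  carrier :> topologicalType;
  carrier_hausdorff : hausdorff_space carrier;
  carrier_second_countable : @second_countable carrier;
  atlas : set (chart R n carrier);
  atlas_cover : forall p, exists2 c, atlas c & cdom c p;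
  atlas_compatible : forall c d, atlas c -> atlas d ->
    Cinfty (ccod c `&` cinv c @^-1` cdom d) (d \o cinv c)
}.

Section TangentBundle.
Context {R : realType} {n : nat} (M : manifold R n).

Definition chart_at (p : M) : chart R n M := s2val (cid2 (atlas_cover p)).

(* The tangent space T_p M is 'rV[R]_n: a vector is given by its components in
   the chart chart_at p. Hence vectors at distinct points are never comparable
   without a change of coordinates, and a vector field is a raw function whose
   smoothness is expressed by smooth_vfield_near below. *)
Definition vfield := M -> 'rV[R]_n.

(* The derivative of h at p along the tangent vector v at p. *)
Definition dirder {W : normedModType R} (h : M -> W) (p : M) (v : 'rV[R]_n) : W :=
  'D_v (h \o cinv (chart_at p)) (chart_at p p).

(* The components of X in the chart c. *)
Definition coord (c : chart R n M) (X : vfield) : M -> 'rV[R]_n :=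
  fun q => dirder c q (X q).

Definition smooth_on {W : normedModType R} (U : set M) (f : M -> W) : Prop :=
  forall c, atlas c -> Cinfty (ccod c `&` cinv c @^-1` (U : set M)) (f \o cinv c).

Definition smooth_near {W : normedModType R} (p : M) (f : M -> W) : Prop :=
  exists2 U : set M, open_nbhs p U & smooth_on U f.

Definition smooth_vfield_near (p : M) (X : vfield) : Prop :=
  exists2 U : set M, open_nbhs p U &
    forall c, atlas c -> smooth_on (U `&` cdom c) (coord c X).

(* [X, Y]^i = X (Y^i) - Y (X^i), components being taken in chart_at p. *)
Definition bracket (X Y : vfield) : vfield := fun p =>
  dirder (coord (chart_at p) Y) p (X p) - dirder (coord (chart_at p) X) p (Y p).

Definition bilinear_form := M -> 'rV[R]_n -> 'rV[R]_n -> R.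
Definition endo_field := M -> 'rV[R]_n -> 'rV[R]_n.
Definition covector_field := M -> 'rV[R]_n -> R.
Definition covariant_derivative := vfield -> vfield -> vfield.

Record riemannian_metric (g : bilinear_form) : Prop := {
  metric_sym : forall p u v, g p u v = g p v u;
  metric_linear : forall p a u v w, g p (a *: u + v) w = a * g p u w + g p v w;
  metric_pos : forall p v, v != 0 -> 0 < g p v v;
  metric_smooth : forall p X Y, smooth_vfield_near p X -> smooth_vfield_near p Y ->
    smooth_near p (fun q => g q (X q) (Y q) : R^o)
}.

Record tensor11 (phi : endo_field) : Prop := {
  tensor11_linear : forall p a u v, phi p (a *: u + v) = a *: phi p u + phi p v;
  tensor11_smooth : forall p X, smooth_vfield_near p X ->
    smooth_vfield_near p (fun q => phi q (X q))
}.

Record one_form (eta : covector_field) : Prop := {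
  one_form_linear : forall p a u v, eta p (a *: u + v) = a * eta p u + eta p v;
  one_form_smooth : forall p X, smooth_vfield_near p X ->
    smooth_near p (fun q => eta q (X q) : R^o)
}.

(* The Levi-Civita connection, acting on vector fields and functions defined and
   smooth near the point under consideration (their values elsewhere are
   immaterial: locality follows from the Leibniz rule). *)
Record levi_civita (g : bilinear_form) (nabla : covariant_derivative) : Prop := {
  nabla_smooth : forall p X Y,
    smooth_vfield_near p X -> smooth_vfield_near p Y ->
    smooth_vfield_near p (nabla X Y);
  nabla_addl : forall p X X' Y,
    smooth_vfield_near p X -> smooth_vfield_near p X' -> smooth_vfield_near p Y ->
    nabla (fun q => X q + X' q) Y p = nabla X Y p + nabla X' Y p;
  nabla_scalel : forall p (f : M -> R^o) X Y,
    smooth_near p f -> smooth_vfield_near p X -> smooth_vfield_near p Y ->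
    nabla (fun q => f q *: X q) Y p = f p *: nabla X Y p;
  nabla_addr : forall p X Y Y',
    smooth_vfield_near p X -> smooth_vfield_near p Y -> smooth_vfield_near p Y' ->
    nabla X (fun q => Y q + Y' q) p = nabla X Y p + nabla X Y' p;
  nabla_leibniz : forall p (f : M -> R^o) X Y,
    smooth_near p f -> smooth_vfield_near p X -> smooth_vfield_near p Y ->
    nabla X (fun q => f q *: Y q) p = dirder f p (X p) *: Y p + f p *: nabla X Y p;
  nabla_torsion_free : forall p X Y,
    smooth_vfield_near p X -> smooth_vfield_near p Y ->
    nabla X Y p - nabla Y X p = bracket X Y p;
  nabla_metric : forall p X Y Z,
    smooth_vfield_near p X -> smooth_vfield_near p Y -> smooth_vfield_near p Z ->
    dirder (fun q => g q (Y q) (Z q) : R^o) p (X p)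
    = g p (nabla X Y p) (Z p) + g p (Y p) (nabla X Z p)
}.

Definition curvature (nabla : covariant_derivative) (X Y Z : vfield) : vfield :=
  fun p => nabla X (nabla Y Z) p - nabla Y (nabla X Z) p - nabla (bracket X Y) Z p.

Definition app (phi : endo_field) (X : vfield) : vfield := fun q => phi q (X q).

Record almost_contact_metric (phi : endo_field) (xi : vfield)
    (eta : covector_field) (g : bilinear_form) : Prop := {
  acm_odd : odd n;
  acm_phi : tensor11 phi;
  acm_xi : forall p, smooth_vfield_near p xi;
  acm_eta : one_form eta;
  acm_metric : riemannian_metric g;
  acm_phi2 : forall p v, phi p (phi p v) = - v + eta p v *: xi p;
  acm_phi_xi : forall p, phi p (xi p) = 0;
  acm_eta_phi : forall p v, eta p (phi p v) = 0;
  acm_eta_xi : forall p, eta p (xi p) = 1;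
  acm_compatible : forall p u v,
    g p (phi p u) (phi p v) = g p u v - eta p u * eta p v;
  acm_eta_dual : forall p v, eta p v = g p v (xi p)
}.

(* Exterior derivatives, without the factors 1/2 and 1/3 of another common
   convention. *)
Definition d1 (eta : covector_field) (X Y : vfield) (p : M) : R :=
  dirder (fun q => eta q (Y q) : R^o) p (X p)
  - dirder (fun q => eta q (X q) : R^o) p (Y p)
  - eta p (bracket X Y p).

Definition d2 (w : bilinear_form) (X Y Z : vfield) (p : M) : R :=
  dirder (fun q => w q (Y q) (Z q) : R^o) p (X p)
  + dirder (fun q => w q (Z q) (X q) : R^o) p (Y p)
  + dirder (fun q => w q (X q) (Y q) : R^o) p (Z p)
  - w p (bracket X Y p) (Z p)
  - w p (bracket Y Z p) (X p)
  - w p (bracket Z X p) (Y p).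

Definition nijenhuis (phi : endo_field) (X Y : vfield) (p : M) : 'rV[R]_n :=
  phi p (phi p (bracket X Y p)) + bracket (app phi X) (app phi Y) p
  - phi p (bracket (app phi X) Y p) - phi p (bracket X (app phi Y) p).

(* With d1 normalised as above, normality is usually written
   [phi, phi] + 2 d eta (x) xi = 0 for d eta = d1 / 2. *)
Record cosymplectic (phi : endo_field) (xi : vfield)
    (eta : covector_field) (g : bilinear_form) : Prop := {
  cosymplectic_acm : almost_contact_metric phi xi eta g;
  cosymplectic_normal : forall p X Y,
    smooth_vfield_near p X -> smooth_vfield_near p Y ->
    nijenhuis phi X Y p + d1 eta X Y p *: xi p = 0;
  cosymplectic_eta_closed : forall p X Y,
    smooth_vfield_near p X -> smooth_vfield_near p Y -> d1 eta X Y p = 0;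
  cosymplectic_Phi_closed : forall p X Y Z,
    smooth_vfield_near p X -> smooth_vfield_near p Y -> smooth_vfield_near p Z ->
    d2 (fun q u v => g q u (phi q v)) X Y Z p = 0
}.

(* The phi-sectional curvature at p of the tangent vector E p. *)
Definition phi_sectional (phi : endo_field) (g : bilinear_form)
    (nabla : covariant_derivative) (E : vfield) (p : M) : R :=
  g p (curvature nabla E (app phi E) (app phi E) p) (E p).

End TangentBundle.

Section Submersion.
Context {R : realType} {m n : nat} {M : manifold R m} {N : manifold R n}.
Variables (F : M -> N) (gM : bilinear_form M) (gN : bilinear_form N).

Definition smooth_map : Prop :=
  continuous F /\
  forall d, atlas d -> smooth_on (F @^-1` cdom d) (d \o F).

(* F_* at p, from T_p M to T_{F p} N *)
Definition pushforward (p : M) (v : 'rV[R]_m) : 'rV[R]_n :=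
  dirder (chart_at (F p) \o F) p v.

Definition vertical (p : M) (v : 'rV[R]_m) : Prop := pushforward p v = 0.

Definition horizontal (p : M) (v : 'rV[R]_m) : Prop :=
  forall w, vertical p w -> gM p v w = 0.

Record riemannian_submersion : Prop := {
  submersion_smooth : smooth_map;
  submersion_surj : forall y, exists p, F p = y;
  submersion_rank : forall p w, exists v, pushforward p v = w;
  submersion_isometry : forall p v, horizontal p v ->
    gN (F p) (pushforward p v) (pushforward p v) = gM p v v
}.

(* (ker F_* )^perp = phi (ker F_* ) (+) {xi}; the second clause says that the sum
   is direct. *)
Definition horizontal_decomposition (phi : endo_field M) (xi : vfield M) : Prop :=
  forall p,
    (forall v, horizontal p v <->
       exists w a, vertical p w /\ v = phi p w + a *: xi p) /\
    (forall w a, vertical p w -> phi p w = a *: xi p -> phi p w = 0).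

(* The orthogonal projection onto ker F_*: the unique w satisfying the two
   conditions (0 is a default value that is never used). *)
Definition vproj : endo_field M := fun p v =>
  xget 0 [set w | vertical p w /\ horizontal p (v - w)].

Definition hproj : endo_field M := fun p v => v - vproj p v.

Variable nabla : covariant_derivative M.

Definition oneillT (E G : vfield M) : vfield M := fun p =>
  hproj p (nabla (app vproj E) (app vproj G) p)
  + vproj p (nabla (app vproj E) (app hproj G) p).

(* (nabla_E T)(A, B) *)
Definition nabla_oneillT (E A B : vfield M) : vfield M := fun p =>
  nabla E (oneillT A B) p - oneillT (nabla E A) B p - oneillT A (nabla E B) p.

End Submersion.

(* Main.v *)
Require Import Defs.
From mathcomp Require Import all_boot all_order all_algebra.
From mathcomp Require Import all_classical all_reals all_analysis.
From mathcomp Require Import ring lra.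

(* On a cosymplectic manifold phi and xi are parallel, so phi commutes with the
   connection and with the curvature. Let V be a vertical field and X = phi V, which is
   horizontal. By O'Neill's lemma nabla_X X is horizontal (the products of horizontal
   fields that project to the base are constant along the fibres); it equals
   phi (nabla_X V), so nabla_X V is vertical: the integrability tensor A vanishes on the
   plane of X and V. O'Neill's formula for a mixed plane then reduces to
   g(R(X, V)V, X) = g((nabla_X T)(V, V), X) - |T_V X|^2.
   This is the second claim, as a horizontal X orthogonal to xi is phi of a vertical
   vector. For the first, R(V, phi V) commutes with phi, and T_V (phi V) = phi (T_V V)
   with T_V V orthogonal to xi. Both sides depend only on the values of the fields at
   the point, so the field may be assumed vertical in a neighbourhood. *)

Set Implicit Arguments.
Unset Strict Implicit.
Unset Printing Implicit Defensive.

Import Order.TTheory GRing.Theory Num.Theory.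
Import numFieldNormedType.Exports.

Local Open Scope classical_set_scope.
Local Open Scope ring_scope.

(** * Calculus of C^k maps on open subsets of R^n *)

(** The structure equation is derived, not assumed: normality and the closedness of Phi and [eta]
    become linear relations between values of nabla Phi and nabla eta at permuted arguments, and
    solving them gives nabla xi = 0 and then nabla phi = 0. In O'Neill's lemma, fields that project
    to the base are avoided: the identity V g(X, Y) = g([V, X], Y) + g(X, [V, Y]), valid for all
    horizontal X, Y and vertical V near the point, takes their place. Two features of the setting
    shape the rest. Fields are raw functions, smooth only near a point, and the projections are
    chosen pointwise; so the smoothness of the projections comes from inverting a Gram matrix of
    gradients, and tensoriality must be proved for operators on such raw functions. Moreover [Ck]
    speaks of directional derivatives only, so additivity in the direction, symmetry of second
    derivatives and the chain rule are recovered from the one-variable mean value theorem. *)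

Lemma near_eq_continuous {T U : topologicalType} (f g : T -> U) (x : T) : {near x, f =1 g} ->
  {for x, continuous f} -> {for x, continuous g}.
Proof.
move=> fg cf; have E := nbhs_singleton fg.
have {}cf : f @ x --> f x := cf.
have cg : g @ x --> f x by apply: cvg_trans (near_eq_cvg fg) cf.
by rewrite E in cg.
Qed.

Section Calculus.
Context {R : realType}.

Section OpenSets.
Context {n : nat} {W : normedModType R}.
Implicit Types (U V : set 'rV[R]_n) (f g : 'rV[R]_n -> W) (k : nat).

Lemma Ck_sub k U V f : V `<=` U -> Ck k U f -> Ck k V f.
Proof.
move=> VU; elim: k f => [|k IH] f /= [cf df].
  by split=> // x /VU /cf.
split=> [x /VU /cf //|v]; have [d1 d2] := df v.
by split=> [x /VU /d1 //|]; exact: IH.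
Qed.

Lemma open_near U f g : open U -> (forall x, U x -> f x = g x) ->
  forall x, U x -> {near x, f =1 g}.
Proof.
by move=> oU fg x Ux; near=> y; apply: fg; near: y; apply: open_nbhs_nbhs.
Unshelve. all: by end_near. Qed.

(** A derivative at a point of [U] sees a whole neighbourhood, which lies in [U] because [U] is
    open. *)
Lemma Ck_eq k U f g : open U -> (forall x, U x -> f x = g x) ->
  Ck k U f -> Ck k U g.
Proof.
move=> oU; elim: k f g => [|k IH] f g fg /= [cf df].
  by split=> // x Ux; exact: near_eq_continuous (open_near oU fg Ux) (cf x Ux).
split=> [x Ux|v].
  exact: near_eq_continuous (open_near oU fg Ux) (cf x Ux).
have [d1 d2] := df v; split=> [x Ux|].
  exact: near_eq_derivable (open_near oU fg Ux) (d1 x Ux).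
by apply: IH d2 => x Ux; apply: near_eq_derive; exact: open_near oU fg _ Ux.
Qed.

Lemma CkS k U f : Ck k.+1 U f -> Ck k U f.
Proof.
elim: k f => [|k IH] f [cf df]; first by [].
by split=> // v; have [d1 d2] := df v; split=> //; exact: IH.
Qed.

Lemma Ck_continuous k U f x : Ck k U f -> U x -> {for x, continuous f}.
Proof. by case: k => [|k] [cf _] Ux; exact: cf. Qed.

Lemma Ck_derivable k U f x v : Ck k.+1 U f -> U x -> derivable f x v.
Proof. by move=> [_ /(_ v)[d1 _]] Ux; exact: d1. Qed.

Lemma Ck_derive k U f v : Ck k.+1 U f -> Ck k U ('D_v f).
Proof. by move=> [_ /(_ v)[]]. Qed.

Lemma Ck_cst k U (a : W) : Ck k U (fun=> a).
Proof.
elim: k a => [|k IH] a; first by split=> // x _; exact: cst_continuous.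
split=> [x _|v]; first exact: cst_continuous.
split=> [x _|]; first exact: derivable_cst.
have -> : 'D_v (fun=> a) = (fun=> 0) :> ('rV[R]_n -> W).
  by apply/funext => x; exact: derive_cst.
exact: IH.
Qed.

Lemma Ck_add k U f g : open U -> Ck k U f -> Ck k U g ->
  Ck k U (fun x => f x + g x).
Proof.
move=> oU; elim: k f g => [|k IH] f g [cf df] [cg dg].
  by split=> // x Ux; apply: continuousD; [exact: cf|exact: cg].
split=> [x Ux|v]; first by apply: continuousD; [exact: cf|exact: cg].
have [f1 f2] := df v; have [g1 g2] := dg v; split=> [x Ux|].
  by apply: derivableD; [exact: f1|exact: g1].
apply: (Ck_eq oU _ (IH _ _ f2 g2)) => x Ux.
by rewrite [RHS](deriveD (f1 _ Ux) (g1 _ Ux)).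
Qed.

End OpenSets.

Section Scalar.
Context {n : nat}.
Implicit Types (U V : set 'rV[R]_n) (f g : 'rV[R]_n -> R^o) (k : nat).

Lemma Ck_mul k U f g : open U -> Ck k U f -> Ck k U g ->
  Ck k U (fun x => f x * g x : R^o).
Proof.
move=> oU; elim: k f g => [|k IH] f g hf hg.
  case: hf hg => cf df [cg dg].
  by split=> // x Ux; apply: continuousM; [exact: cf|exact: cg].
have [cf df] := hf; have [cg dg] := hg.
split=> [x Ux|v]; first by apply: continuousM; [exact: cf|exact: cg].
have [f1 f2] := df v; have [g1 g2] := dg v; split=> [x Ux|].
  by apply: derivableM; [exact: f1|exact: g1].
apply: Ck_eq (Ck_add oU (IH _ _ (CkS hf) g2) (IH _ _ (CkS hg) f2)) => // x Ux.
by rewrite [RHS](deriveM (f1 _ Ux) (g1 _ Ux)).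
Qed.

Lemma Ck_opp k U f : open U -> Ck k U f -> Ck k U (fun x => - f x : R^o).
Proof.
move=> oU hf; apply: Ck_eq (Ck_mul oU (Ck_cst k U (-1 : R^o)) hf) => // x _.
by rewrite mulN1r.
Qed.

(** The derivative of 1/f is - f' / f^2, so the induction hypothesis for 1/f itself yields one more
    order. *)
Lemma Ck_inv k U f : open U -> (forall x, U x -> f x != 0) -> Ck k U f ->
  Ck k U (fun x => (f x)^-1 : R^o).
Proof.
move=> oU f0; elim: k => [|k IH] hf.
  case: hf => cf _; split=> // x Ux; apply: continuousV; first exact: f0.
  exact: cf.
have [cf df] := hf.
split=> [x Ux|v]; first by apply: continuousV; [exact: f0|exact: cf].
have [f1 f2] := df v; split=> [x Ux|].
  by apply: derivableV; [exact: f0|exact: f1].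
have hi := IH (CkS hf).
apply: Ck_eq (Ck_opp oU (Ck_mul oU (Ck_mul oU hi hi) f2)) => // x Ux.
rewrite [RHS](deriveV (f0 _ Ux) (f1 _ Ux)) -[in RHS]mulr_algl /=.
by rewrite !scaler1 expr2 invfM mulNr.
Qed.

Lemma Ck_sum k U (I : finType) (P : pred I) (F : I -> 'rV[R]_n -> R^o) : open U ->
  (forall i, Ck k U (F i)) -> Ck k U (fun x => \sum_(i | P i) F i x : R^o).
Proof.
move=> oU hF.
pose S s x : R^o := \sum_(i <- s | P i) F i x.
suff H s : Ck k U (S s) by exact: H.
elim: s => [|i s IH].
  by apply: Ck_eq (Ck_cst k U (0 : R^o)) => // x _; rewrite /S big_nil.
have [Pi|nPi] := boolP (P i); last first.
  by apply: Ck_eq IH => // x _; rewrite /S big_cons (negbTE nPi).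
by apply: Ck_eq (Ck_add oU (hF i) IH) => // x _; rewrite /S big_cons Pi.
Qed.

(** On the line through [x] along [v], [f] becomes a function [g] of one real variable, where
    derivable means differentiable; homogeneity in the direction is the linearity of the
    differential of [g] at 0. *)
Lemma derivableZv f x v (a : R) : derivable f x v ->
  derivable f x (a *: v) /\ 'D_(a *: v) f x = a * 'D_v f x.
Proof.
move=> df; pose g (h : R) : R^o := f (h *: v + x).
have dg : differentiable g 0 by apply/derivable1_diffP; exact: ((derivable1P f x v).1 df).
have E (b : R) : (fun h : R => h^-1 *: (f (h *: (b *: v) + x) - f x)) =
    (fun h : R => h^-1 *: (g (h *: (b : R^o) + 0) - g 0)).
  by apply/funext => h; rewrite /g addr0 scale0r add0r scalerA.
have D (b : R) : 'D_(b *: v) f x = 'd g 0 b.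
  by rewrite -(deriveE _ dg) /derive /=; congr (lim _); rewrite E.
split.
  have := @diff_derivable _ _ _ g 0 (a : R^o) dg.
  by rewrite /derivable /= -E.
rewrite -[v in RHS]scale1r !D.
have : 'd g 0 (a *: (1 : R^o)) = a *: 'd g 0 (1 : R^o) by exact: linearZ.
by rewrite [a *: 1]mulr1.
Qed.

End Scalar.

Section Components.
Context {n m : nat}.
Implicit Types (U : set 'rV[R]_n) (f : 'rV[R]_n -> 'rV[R]_m).

Lemma cvg_row {T : Type} {F : set_system T} {FF : Filter F} (f : T -> 'rV[R]_m)
  (l : 'rV[R]_m) : (forall j, (fun t => f t 0 j : R^o) @ F --> (l 0 j : R^o)) ->
  f @ F --> l.
Proof.
move=> cf; apply/cvgrPdist_le => /= e e0; near=> y.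
rewrite /Num.Def.normr/= mx_normrE (bigmax_le _ (ltW e0))//= => -[i j] _.
rewrite !mxE/= ord1; move: j; near: y; apply: filter_forall => j.
exact: ((cvgrPdist_le _ _).1 (cf j)).
Unshelve. all: by end_near. Qed.

Lemma continuous_rowP f x : {for x, continuous f} <->
  forall j, {for x, continuous (fun y => f y 0 j : R^o)}.
Proof.
split=> [cf j|cf].
  apply: (@continuous_comp _ _ _ f (fun M : 'rV[R]_m => M 0 j : R^o)) => //.
  exact: coord_continuous.
exact: (cvg_row cf).
Qed.

Lemma derivable_rowP f x v : derivable f x v <->
  forall j, derivable (fun y => f y 0 j : R^o) x v.
Proof.
rewrite derivable_mxP; split=> [H j|H i j]; first exact: H.
by rewrite ord1; exact: H.
Qed.

Lemma derive_row f x v j : derivable f x v ->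
  'D_v (fun y => f y 0 j : R^o) x = 'D_v f x 0 j.
Proof. by move=> df; rewrite (derive_mx df) mxE. Qed.

Lemma Ck_rowP k U f : open U ->
  Ck k U f <-> forall j, Ck k U (fun x => f x 0 j : R^o).
Proof.
move=> oU; elim: k f => [|k IH] f; split.
- by move=> [cf _] j; split=> // x /cf /continuous_rowP.
- by move=> H; split=> // x Ux; apply/continuous_rowP => j; have [cf _] := H j; exact: cf.
- move=> [cf df] j; split=> [x /cf /continuous_rowP //|v].
  have [d1 d2] := df v; split=> [x /d1 /derivable_rowP //|].
  move: d2 => /IH /(_ j); apply: Ck_eq => // x Ux.
  by rewrite derive_row //; exact: d1.
- move=> H; split=> [x Ux|v].
    by apply/continuous_rowP => j; have [cf _] := H j; exact: cf.
  have D x : U x -> derivable f x v.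
    by move=> Ux; apply/derivable_rowP => j; have [_ /(_ v)[d _]] := H j; exact: d.
  split=> //; apply/IH => j; have [_ /(_ v)[_ d2]] := H j.
  by apply: Ck_eq d2 => // x /D /derive_row.
Qed.

End Components.

End Calculus.

Arguments Ck_continuous {R n W k U f x}.
Arguments Ck_derivable {R n W k U f x} v.
Arguments Ck_derive {R n W k U f} v.
Arguments derivableZv {R n f x v} a.

(** * Consequences of the mean value theorem: linearity in the direction, symmetry of second
    derivatives, chain rule *)

Section MeanValue.
Context {R : realType}.

Section Scalar.
Context {n : nat}.
Implicit Types (U : set 'rV[R]_n) (f : 'rV[R]_n -> R^o) (x y u v w : 'rV[R]_n).

Lemma is_derive_line f y w (t : R) : derivable f (t *: w + y) w ->
  is_derive t 1 (fun s : R => f (s *: w + y)) ('D_w f (t *: w + y)).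
Proof.
move=> df.
have E : (fun h : R => h^-1 *: (f ((h *: (1 : R^o) + t) *: w + y) - f (t *: w + y))) =
    (fun h : R => h^-1 *: (f (h *: w + (t *: w + y)) - f (t *: w + y))).
  by apply/funext => h; rewrite [h *: (1 : R^o)]mulr1 scalerDl addrA.
split; first by move: df; rewrite /derivable /= -E.
by rewrite /derive /= -E.
Qed.

Lemma mvt_line f y w :
  (forall t : R, 0 <= t <= 1 -> derivable f (t *: w + y) w) ->
  exists2 t : R, 0 <= t <= 1 & f (w + y) - f y = 'D_w f (t *: w + y).
Proof.
move=> df; pose g (t : R) : R := f (t *: w + y).
pose dg (t : R) : R := 'D_w f (t *: w + y).
have gP (t : R) : 0 <= t <= 1 -> is_derive t 1 g (dg t).
  by move=> /df; exact: is_derive_line.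
have gP1 (t : R) : t \in `]0, 1[%R -> is_derive t 1 g (dg t).
  by rewrite in_itv /= => /andP[t0 t1]; apply: gP; rewrite !ltW.
have gc : {within `[0, 1], continuous g}.
  by apply: derivable_within_continuous => t; rewrite in_itv /= => /gP [].
have [t t01 E] := MVT_segment ler01 gP1 gc.
exists t; first by move: t01; rewrite in_itv.
by move: E; rewrite /g scale1r scale0r add0r subr0 mulr1.
Qed.

Lemma ball_segment x (r : R) y w (t : R) : ball x r y -> ball x r (w + y) ->
  0 <= t <= 1 -> ball x r (t *: w + y).
Proof.
rewrite -ball_normE /ball_ /= => h1 h2 /andP[t0 t1].
have -> : x - (t *: w + y) = (1 - t) *: (x - y) + t *: (x - (w + y)).
  by apply/rowP => i; rewrite !mxE; ring.
apply: le_lt_trans (ler_normD _ _) _; rewrite !normrZ.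
rewrite (ger0_norm t0) ger0_norm ?subr_ge0 //.
(* The strict bound on [x - (w + y)] survives multiplication by [t] only for nonzero [t]. *)
have [->|tp] := eqVneq t 0; first by rewrite subr0 mul1r mul0r addr0.
rewrite (_ : r = (1 - t) * r + t * r); last by ring.
apply: ler_ltD; first by rewrite ler_wpM2l ?subr_ge0 // ltW.
by rewrite ltr_pM2l // lt_def tp.
Qed.

Lemma mvt_ball f x (r : R) y w : (forall z, ball x r z -> derivable f z w) ->
  ball x r y -> ball x r (w + y) ->
  exists2 z, ball x r z & f (w + y) - f y = 'D_w f z.
Proof.
move=> df h1 h2; have [|t t01 E] := @mvt_line f y w.
  by move=> t t01; apply: df; exact: ball_segment.
by exists (t *: w + y) => //; exact: ball_segment.
Qed.

Lemma near0_scale_lt u (r : R) : 0 < r -> \forall h \near (0 : R)^', `|h *: u| < r.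
Proof.
(* Adding 1 keeps the divisor positive when [u = 0]. *)
move=> r0; have u0 : 0 < `|u| + 1 by rewrite ltr_wpDl.
near=> h; rewrite normrZ.
have h1 : `|h| < r / (`|u| + 1).
  by near: h; apply: dnbhs0_lt; rewrite divr_gt0.
rewrite (le_lt_trans (y := `|h| * (`|u| + 1))) //.
  by rewrite ler_wpM2l // lerDl.
by rewrite -ltr_pdivlMr.
Unshelve. all: by end_near. Qed.

Lemma open_ball U x : open U -> U x -> exists2 r : R, 0 < r & ball x r `<=` U.
Proof.
move=> oU Ux; have /nbhs_ballP[r /= r0 rU] := open_nbhs_nbhs (conj oU Ux).
by exists r.
Qed.

(** The quotient along [u + v] is the quotient along [u] plus, by the mean value theorem, the value
    of ['D_v f] at a point near [x]; continuity of ['D_v f] moves that point to [x]. Each of the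
    three errors gets [e / 3]. *)
Lemma deriveDv U f x u v : open U -> Ck 1 U f -> U x ->
  'D_(u + v) f x = 'D_u f x + 'D_v f x.
Proof.
move=> oU C1 Ux; apply/eqP; rewrite -subr_eq0 -normr_le0.
apply/ler_addgt0Pl => e e0; rewrite addr0.
have cv := Ck_continuous (Ck_derive v C1) Ux.
have [r0 r00 r0U] := open_ball oU Ux.
have e3 : 0 < e / 3 by rewrite divr_gt0.
have /cvgrPdist_le/(_ _ e3)/nbhs_ballP[r1 /= r10 r1P] := cv.
pose r := Num.min r0 r1.
have r_gt0 : 0 < r by rewrite lt_min r00.
have rU z : ball x r z -> U z /\ `|'D_v f x - 'D_v f z| <= e / 3.
  move=> xz; split; first by apply: r0U; apply: le_ball xz; rewrite ge_min lexx.
  by apply: r1P; apply: le_ball xz; rewrite ge_min lexx orbT.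
have /cvgrPdist_le/(_ _ e3) n1 := Ck_derivable (u + v) C1 Ux.
have /cvgrPdist_le/(_ _ e3) n2 := Ck_derivable u C1 Ux.
have r2 : 0 < r / 2 by rewrite divr_gt0.
have H : \forall h \near (0 : R)^', `|'D_(u + v) f x - ('D_u f x + 'D_v f x)| <= e.
  near=> h.
  have h0 : h != 0 by near: h; exact: nbhs_dnbhs_neq.
  have hu : `|h *: u| < r / 2 by near: h; exact: near0_scale_lt.
  have hv : `|h *: v| < r / 2 by near: h; exact: near0_scale_lt.
  have q1 : `|'D_(u + v) f x - h^-1 *: (f (h *: (u + v) + x) - f x)| <= e / 3.
    by near: h.
  have q2 : `|'D_u f x - h^-1 *: (f (h *: u + x) - f x)| <= e / 3 by near: h.
  have [z|||z xz E] := @mvt_ball f x r (h *: u + x) (h *: v).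
  - by move=> /rU[Uz _]; exact: (derivableZv h (Ck_derivable v C1 Uz)).1.
  - rewrite -ball_normE /ball_ /= opprD addrCA subrr addr0 normrN.
    by rewrite (lt_trans hu) // ltr_pdivrMr // ltr_pMr // ltr1n.
  - rewrite -ball_normE /ball_ /= !opprD [- _ - x]addrC !addrA.
    rewrite [x - _ - x]addrAC subrr add0r -opprD normrN.
    by rewrite (le_lt_trans (ler_normD _ _)) // [r]splitr ltrD.
  have [Uz q3] := rU z xz.
  rewrite (derivableZv h (Ck_derivable v C1 Uz)).2 in E.
  have Q : h^-1 *: (f (h *: (u + v) + x) - f x) =
      h^-1 *: (f (h *: u + x) - f x) + 'D_v f z.
    have -> : 'D_v f z = h^-1 *: (h * 'D_v f z) by rewrite [RHS]mulKf.
    rewrite -E -scalerDr; congr (_ *: _).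
    by rewrite [RHS]addrC subrKA scalerDr addrA [h *: v + h *: u]addrC.
  move: q1; rewrite Q.
  set a := 'D_(u + v) f x in q2 q3 *; set b := 'D_u f x in q2 q3 *.
  set c := 'D_v f x in q2 q3 *; set k := h^-1 *: _ in q2 q3 *.
  set d := 'D_v f z in q2 q3 * => q1.
  have -> : a - (b + c) = (a - (k + d)) - (b - k) - (c - d) by ring.
  rewrite (_ : e = e / 3 + e / 3 + e / 3); last by field.
  by do 2! (apply: le_trans (ler_normB _ _) _; apply: lerD => //).
by have [h] := filter_ex H.
Unshelve. all: by end_near. Qed.

Lemma derive_sumv U f x (I : Type) (s : seq I) (a : I -> R) (u : I -> 'rV[R]_n) :
  open U -> Ck 1 U f -> U x ->
  'D_(\sum_(i <- s) a i *: u i) f x = \sum_(i <- s) a i * 'D_(u i) f x.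
Proof.
move=> oU C1 Ux; elim: s => [|i s IH]; first by rewrite !big_nil derive0.
rewrite !big_cons (deriveDv _ _ oU C1 Ux) IH.
by rewrite (derivableZv _ (Ck_derivable _ C1 Ux)).2.
Qed.

Lemma derive_coords U f x v : open U -> Ck 1 U f -> U x ->
  'D_v f x = \sum_j v 0 j * 'D_(delta_mx 0 j) f x.
Proof. by move=> oU C1 Ux; rewrite [in LHS](row_sum_delta v) (derive_sumv _ _ _ oU C1 Ux). Qed.

(** The mean value theorem is used twice: for the function sending [y] to [f (h *: v + y) - f y],
    along [u], and then for ['D_u f], along [v]. The doubled radius leaves room for the shift by
    [h *: v]. *)
Lemma second_difference U f x (r h : R) u v : open U -> Ck 2 U f ->
  ball x (r + r) `<=` U -> `|h *: u| < r -> `|h *: v| < r ->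
  exists2 z, ball x (r + r) z &
    f (h *: u + (h *: v + x)) - f (h *: v + x) - (f (h *: u + x) - f x)
    = h * h * 'D_v ('D_u f) z.
Proof.
move=> oU C2 bU hu hv.
have C1 := CkS C2.
have r0 : 0 < r by apply: le_lt_trans hu.
have bS y : ball x r y -> ball x (r + r) y by apply: le_ball; rewrite lerDl ltW.
have shift y : ball x r y -> ball x (r + r) (h *: v + y).
  rewrite -ball_normE /ball_ /= => xy; rewrite opprD addrCA.
  by rewrite (le_lt_trans (ler_normD _ _)) // normrN ltrD.
pose F (y : 'rV[R]_n) : R^o := f (h *: v + y) - f y.
have dF y : ball x r y -> is_derive y u F ('D_u f (h *: v + y) - 'D_u f y).
  move=> xy; apply: is_deriveB.
  - have E : (fun k : R => k^-1 *: (f (h *: v + (k *: u + y)) - f (h *: v + y))) =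
        (fun k : R => k^-1 *: (f (k *: u + (h *: v + y)) - f (h *: v + y))).
      by apply/funext => k; rewrite addrCA.
    have := Ck_derivable u C1 (bU _ (shift _ xy)) => d.
    split; first by move: d; rewrite /derivable /= -E.
    by rewrite /derive /= -E.
  - by apply: derivableP; exact: Ck_derivable C1 (bU _ (bS _ xy)).
have [z|||y xy E] := @mvt_ball F x r x (h *: u).
- by move=> xz; apply: (derivableZv h _).1; have [] := dF _ xz.
- exact: ballxx.
- by rewrite -ball_normE /ball_ /= opprD addrCA subrr addr0 normrN.
have [z|||z xz E2] := @mvt_ball ('D_u f) x (r + r) y (h *: v).
- move=> xz; apply: (derivableZv h _).1.
  exact: Ck_derivable (Ck_derive u C2) (bU _ xz).
- exact: bS.
- exact: shift.
exists z => //.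
have dFy := dF _ xy.
transitivity (F (h *: u + x) - F x).
  by rewrite /F [h *: v + (h *: u + x)]addrCA; ring.
rewrite E (derivableZv h (@ex_derive _ _ _ _ _ _ _ dFy)).2 (@derive_val _ _ _ _ _ _ _ dFy).
rewrite E2 (derivableZv h (Ck_derivable v (Ck_derive u C2) (bU _ xz))).2.
by rewrite mulrA.
Qed.

(** The second difference of [f] is symmetric in [u] and [v], so the two mixed derivatives agree at
    points [z1] and [z2] near [x]; continuity brings both points to [x]. *)
Lemma derive_symmetric U f x u v : open U -> Ck 2 U f -> U x ->
  'D_u ('D_v f) x = 'D_v ('D_u f) x.
Proof.
move=> oU C2 Ux; apply/eqP; rewrite -subr_eq0 -normr_le0.
apply/ler_addgt0Pl => e e0; rewrite addr0.
have c1 := Ck_continuous (Ck_derive v (Ck_derive u C2)) Ux.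
have c2 := Ck_continuous (Ck_derive u (Ck_derive v C2)) Ux.
have [r0 r00 r0U] := open_ball oU Ux.
have e2 : 0 < e / 2 by rewrite divr_gt0.
have /cvgrPdist_le/(_ _ e2)/nbhs_ballP[r1 /= r10 r1P] := c1.
have /cvgrPdist_le/(_ _ e2)/nbhs_ballP[r2 /= r20 r2P] := c2.
pose r := Num.min r0 (Num.min r1 r2).
have r_gt0 : 0 < r by rewrite !lt_min r00 r10.
have rU : ball x (r / 2 + r / 2) `<=` U.
  by move=> z; rewrite -splitr => xz; apply: r0U; apply: le_ball xz; rewrite ge_min lexx.
have r12 : 0 < r / 2 by rewrite divr_gt0.
have H : \forall h \near (0 : R)^', `|'D_u ('D_v f) x - 'D_v ('D_u f) x| <= e.
  near=> h.
  have h0 : h != 0 by near: h; exact: nbhs_dnbhs_neq.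
  have hu : `|h *: u| < r / 2 by near: h; exact: near0_scale_lt.
  have hv : `|h *: v| < r / 2 by near: h; exact: near0_scale_lt.
  have [z1 xz1 E1] := second_difference oU C2 rU hu hv.
  have [z2 xz2 E2] := second_difference oU C2 rU hv hu.
  have E : 'D_v ('D_u f) z1 = 'D_u ('D_v f) z2.
    have hh : h * h != 0 by rewrite mulf_neq0.
    have sub4C (a b c d : R) : a - b - (c - d) = a - c - (b - d) by ring.
    move: E1 E2; rewrite [h *: v + (h *: u + x)]addrCA sub4C => -> E2.
    exact: mulfI hh _ _ E2.
  rewrite -splitr in xz1 xz2.
  have q1 : `|'D_v ('D_u f) x - 'D_v ('D_u f) z1| <= e / 2.
    by apply: r1P; apply: le_ball xz1; rewrite !ge_min lexx orbT.
  have q2 : `|'D_u ('D_v f) x - 'D_u ('D_v f) z2| <= e / 2.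
    by apply: r2P; apply: le_ball xz2; rewrite !ge_min lexx !orbT.
  move: q1; rewrite E => q1.
  rewrite -(subrKA ('D_u ('D_v f) z2)) [leRHS]splitr.
  apply: le_trans (ler_normD _ _) _; apply: lerD; first exact: q2.
  by rewrite distrC; exact: q1.
by have [h] := filter_ex H.
Unshelve. all: by end_near. Qed.

End Scalar.

Lemma cvg_finsum {T : Type} {F : set_system T} {FF : Filter F} (I : finType)
  (f : I -> T -> R) (l : I -> R) : (forall i, f i @ F --> l i) ->
  (fun t => \sum_i f i t) @ F --> \sum_i l i.
Proof.
move=> fl.
suff H s : (fun t => \sum_(i <- s) f i t) @ F --> \sum_(i <- s) l i by exact: H.
elim: s => [|i s IH].
  by under eq_fun do rewrite big_nil; rewrite big_nil; exact: cvg_cst.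
by under eq_fun do rewrite big_cons; rewrite big_cons; exact: cvgD.
Qed.

Section Composition.
Context {n m : nat}.

(** The increment [w h] of [g] serves as a direction for [f]: the mean value theorem expresses the
    increment of [f \o g] as ['D_(w h) f] at an intermediate point, and its expansion in partial
    derivatives lets the limit be taken factor by factor. *)
Lemma derive_comp (V : set 'rV[R]_m) (f : 'rV[R]_m -> R^o) (g : 'rV[R]_n -> 'rV[R]_m)
  x v : open V -> Ck 1 V f -> V (g x) -> derivable g x v ->
  is_derive x v (f \o g : _ -> R^o) ('D_('D_v g x) f (g x)).
Proof.
move=> oV C1 Vgx dg.
rewrite (derive_coords _ oV C1 Vgx).
pose q (h : R) := h^-1 *: (g (h *: v + x) - g x).
have qc : q @ (0 : R)^' --> 'D_v g x by exact: dg.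
pose w (h : R) := g (h *: v + x) - g x.
have [r r0 rV] := open_ball oV Vgx.
have wc : w @ (0 : R)^' --> (0 : 'rV[R]_m).
  have : (fun h : R => h *: q h) @ (0 : R)^' --> (0 : R) *: 'D_v g x.
    by apply: cvgZ qc; apply: cvg_within; exact: cvg_id.
  rewrite scale0r; apply: cvg_trans; apply: near_eq_cvg; near=> h.
  by rewrite /q /w scalerA mulfV ?scale1r //; near: h; exact: nbhs_dnbhs_neq.
(* [z h] is the intermediate point on the segment from [g x] to [g x + w h]; when that segment may
   leave [V], the default is [g x], which still satisfies the norm bound. *)
have [z zP] : {z : R -> 'rV[R]_m & forall h, `|z h - g x| <= `|w h| /\
    (`|w h| < r -> f (w h + g x) - f (g x) = 'D_(w h) f (z h))}.
  apply: (@choice _ _ (fun h z => `|z - g x| <= `|w h| /\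
    (`|w h| < r -> f (w h + g x) - f (g x) = 'D_(w h) f z))) => h.
  have [hr|hr] := ltP `|w h| r; last first.
    by exists (g x); rewrite subrr normr0; split.
  have [|t /andP[t0 t1] E] := @mvt_line m f (g x) (w h).
    move=> t t01; apply: (Ck_derivable _ C1); apply: rV; apply: ball_segment t01.
      exact: ballxx.
    by rewrite -ball_normE /ball_ /= opprD addrCA subrr addr0 normrN.
  exists (t *: w h + g x); split=> //.
  by rewrite addrK normrZ ger0_norm // ler_piMl.
have zc : z @ (0 : R)^' --> g x.
  apply/cvgrPdist_le => e e0; near=> h.
  rewrite distrC (le_trans (zP h).1) //; near: h.
  exact: (@cvgr0_norm_le _ _ _ _ _ w wc _ e0).
have H : (fun h : R => \sum_j q h 0 j * 'D_(delta_mx 0 j) f (z h)) @ (0 : R)^' -->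
    \sum_j 'D_v g x 0 j * 'D_(delta_mx 0 j) f (g x).
  apply: cvg_finsum => j; apply: cvgM.
    exact: (cvg_comp _ _ qc (@coord_continuous _ _ _ 0 j _)).
  exact: (cvg_comp _ _ zc (Ck_continuous (Ck_derive _ C1) Vgx)).
have D : (fun h : R => h^-1 *: ((f \o g) (h *: v + x) - (f \o g) x : R^o)) @ (0 : R)^'
    --> (\sum_j 'D_v g x 0 j * 'D_(delta_mx 0 j) f (g x) : R^o).
  apply: cvg_trans H; apply: near_eq_cvg; near=> h.
  have wr : `|w h| < r by near: h; exact: (@cvgr0_norm_lt _ _ _ _ _ w wc _ r0).
  have Vz : V (z h).
    by apply: rV; rewrite -ball_normE /ball_ /= distrC (le_lt_trans (zP h).1).
  rewrite -(derive_coords _ oV C1 Vz) /= /q (derivableZv _ (Ck_derivable _ C1 Vz)).2.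
  by rewrite -(zP h).2 // /w subrK.
split; first by apply/cvg_ex; eexists; exact: D.
exact: cvg_lim D.
Unshelve. all: by end_near. Qed.

(** A derivative of the composite is a sum of components of ['D_v g] times partial derivatives of
    [f] composed with the same [g]; hence the induction varies [f] and keeps [g]. *)
Lemma Ck_comp k (U : set 'rV[R]_n) (V : set 'rV[R]_m) (f : 'rV[R]_m -> R^o)
  (g : 'rV[R]_n -> 'rV[R]_m) : open U -> open V -> (forall x, U x -> V (g x)) ->
  Ck k U g -> Ck k V f -> Ck k U (f \o g : _ -> R^o).
Proof.
move=> oU oV UV; elim: k f => [|k IH] f hg hf.
  case: hg hf => cg _ [cf _]; split=> // x Ux.
  by apply: continuous_comp; [exact: cg|exact/cf/UV].
have C1 : Ck 1 V f by elim: k hf {IH hg} => // k IHk /CkS.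
split=> [x Ux|v].
  apply: continuous_comp; first exact: (Ck_continuous hg).
  exact: (Ck_continuous hf (UV _ Ux)).
have D x : U x -> is_derive x v (f \o g : _ -> R^o) ('D_('D_v g x) f (g x)).
  by move=> Ux; apply: (derive_comp oV C1 (UV _ Ux)); exact: (Ck_derivable _ hg).
split=> [x /D[]//|].
have oS : Ck k U (fun x => \sum_j ('D_v g x 0 j : R^o) * ('D_(delta_mx 0 j) f \o g) x : R^o).
  apply: Ck_sum => // j; apply: Ck_mul => //.
    by move: (Ck_derive v hg) => /(Ck_rowP _ _ oU).
  by apply: IH (CkS hg) _; exact: Ck_derive.
apply: Ck_eq oS => // x Ux.
by have := D x Ux => -[_ ->]; rewrite (derive_coords _ oV C1 (UV _ Ux)).
Qed.

End Composition.

End MeanValue.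

(** * Smooth functions and vector fields on a manifold *)

Section Manifold.
Context {R : realType} {n : nat} {M : manifold R n}.
Implicit Types (c d : chart R n M) (p q : M) (f g : M -> R^o) (U V : set M).
Implicit Types (u v w : 'rV[R]_n) (X Y : vfield M).

Lemma chart_at_atlas p : atlas (chart_at p).
Proof. exact: (s2valP (cid2 (atlas_cover p))). Qed.

Lemma chart_at_dom p : cdom (chart_at p) p.
Proof. exact: (s2valP' (cid2 (atlas_cover p))). Qed.

Lemma chart_open c U : open U -> open (ccod c `&` cinv c @^-1` U).
Proof.
move=> oU; rewrite openE => y [cy Uy]; apply: filterI.
  by apply: open_nbhs_nbhs; split=> //; exact: ccod_open.
by apply: (cinv_continuous cy); exact: open_nbhs_nbhs.
Qed.

Arguments chart_open c {U}.

Lemma chart_cod c U p : cdom c p -> U p -> (ccod c `&` cinv c @^-1` U) (c p).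
Proof. by move=> cp Up; split; [exact: cmap_cod|rewrite /preimage /= cmapK]. Qed.

Lemma chart_near c p (P : set M) : cdom c p -> (\near p, P p) ->
  \forall y \near c p, P (cinv c y).
Proof.
move=> cp Pp; have cc := cmap_cod cp.
by apply: (cinv_continuous cc); rewrite cmapK.
Qed.

Lemma smooth_on_sub {W : normedModType R} U V (f : M -> W) :
  V `<=` U -> smooth_on U f -> smooth_on V f.
Proof.
move=> VU sf c ac k; apply: Ck_sub (sf c ac k).
by move=> y [cy Vy]; split=> //; exact: VU.
Qed.

Lemma smooth_on_eq U f g : open U -> (forall q, U q -> f q = g q) ->
  smooth_on U f -> smooth_on U g.
Proof.
move=> oU fg sf c ac k; apply: Ck_eq (sf c ac k); first exact: chart_open.
by move=> y [_ Uy]; exact: fg.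
Qed.

(** Another chart [d] reads [f] as its expression in [c] preceded by the transition map from [d] to
    [c], which is smooth. *)
Lemma smooth_on_chart c U f : atlas c -> open U -> U `<=` cdom c ->
  Cinfty (ccod c `&` cinv c @^-1` U) (f \o cinv c) -> smooth_on U f.
Proof.
move=> ac oU Uc sf d ad k.
have oO := chart_open d oU.
have H : Ck k (ccod d `&` cinv d @^-1` U) ((f \o cinv c) \o (c \o cinv d)).
  apply: (Ck_comp oO (chart_open c oU)) (sf k).
    move=> y [dy Uy]; apply: chart_cod => //; exact: Uc.
  apply: Ck_sub (atlas_compatible ad ac k).
  by move=> y [dy Uy]; split=> //; exact: Uc.
apply: Ck_eq H => // y [dy Uy] /=.
by rewrite cmapK //; exact: Uc.
Qed.

Lemma smooth_on_row U (f : M -> 'rV[R]_n) : open U ->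
  (forall j, smooth_on U (fun q => f q 0 j : R^o)) <-> smooth_on U f.
Proof.
move=> oU; split=> [H c ac k|H j c ac k].
  by apply/Ck_rowP => [|j]; [exact: chart_open|exact: H].
by have /(Ck_rowP _ _ (chart_open c oU)) := H c ac k; exact.
Qed.

Definition chart_coord c (j : 'I_n) : M -> R^o := fun q => c q 0 j.

Lemma smooth_on_coord c j : atlas c -> smooth_on (cdom c) (chart_coord c j).
Proof.
move=> ac d ad k.
exact: ((Ck_rowP _ _ (chart_open d (cdom_open c))).1 (atlas_compatible ad ac k) j).
Qed.

Lemma smooth_on_partial c U f w : atlas c -> open U -> U `<=` cdom c ->
  smooth_on U f -> smooth_on U (fun q => 'D_w (f \o cinv c) (c q) : R^o).
Proof.
move=> ac oU Uc sf; apply: (smooth_on_chart ac) => // k.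
apply: Ck_eq (Ck_derive w (sf c ac k.+1)); first exact: chart_open.
by move=> y [cy _] /=; rewrite cinvK.
Qed.

Lemma smooth_near_cst p (a : R) : smooth_near p (fun=> a : R^o).
Proof.
exists setT; first by split=> //; exact: openT.
by move=> c ac k; exact: Ck_cst.
Qed.

Lemma smooth_near_nbhs {W : normedModType R} p (f : M -> W) :
  smooth_near p f -> \forall q \near p, smooth_near q f.
Proof.
move=> [U [oU Up] sf]; near=> q; exists U => //; split=> //.
by near: q; exact: open_nbhs_nbhs.
Unshelve. all: by end_near. Qed.

Lemma smooth_near_eq p f g : {near p, f =1 g} -> smooth_near p f -> smooth_near p g.
Proof.
rewrite /prop_near1 nbhsE => -[V [oV Vp] fg] [U [oU Up] sf].
exists (U `&` V); first by split=> //; exact: openI.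
apply: (@smooth_on_eq _ f); first exact: openI.
  by move=> q [_ Vq]; exact: fg.
by apply: smooth_on_sub sf => q [].
Qed.

Lemma smooth_near2 p f g : smooth_near p f -> smooth_near p g ->
  exists2 U, open_nbhs p U & smooth_on U f /\ smooth_on U g.
Proof.
move=> [U [oU Up] sf] [V [oV Vp] sg]; exists (U `&` V).
  by split=> //; exact: openI.
by split; [apply: smooth_on_sub sf|apply: smooth_on_sub sg] => q [].
Qed.

Lemma smooth_nearD p f g : smooth_near p f -> smooth_near p g ->
  smooth_near p (fun q => f q + g q : R^o).
Proof.
move=> /smooth_near2 /[apply] -[U [oU Up] [sf sg]]; exists U => // c ac k.
by apply: Ck_add (sf c ac k) (sg c ac k); exact: chart_open.
Qed.

Lemma smooth_nearM p f g : smooth_near p f -> smooth_near p g ->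
  smooth_near p (fun q => f q * g q : R^o).
Proof.
move=> /smooth_near2 /[apply] -[U [oU Up] [sf sg]]; exists U => // c ac k.
by apply: Ck_mul (sf c ac k) (sg c ac k); exact: chart_open.
Qed.

Lemma smooth_nearN p f : smooth_near p f -> smooth_near p (fun q => - f q : R^o).
Proof.
move=> [U [oU Up] sf]; exists U => // c ac k.
by apply: Ck_opp (sf c ac k); exact: chart_open.
Qed.

Lemma smooth_nearB p f g : smooth_near p f -> smooth_near p g ->
  smooth_near p (fun q => f q - g q : R^o).
Proof. by move=> sf /smooth_nearN; exact: smooth_nearD. Qed.

Lemma smooth_near_sum p (I : finType) (F : I -> M -> R^o) :
  (forall i, smooth_near p (F i)) -> smooth_near p (fun q => \sum_i F i q : R^o).
Proof.
move=> sF; suff H s : smooth_near p (fun q => \sum_(i <- s) F i q : R^o) by exact: H.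
elim: s => [|i s IH].
  by under eq_fun do rewrite big_nil; exact: smooth_near_cst.
by under eq_fun do rewrite big_cons; exact: smooth_nearD.
Qed.

Lemma smooth_near_prod p (I : finType) (F : I -> M -> R^o) :
  (forall i, smooth_near p (F i)) -> smooth_near p (fun q => \prod_i F i q : R^o).
Proof.
move=> sF; suff H s : smooth_near p (fun q => \prod_(i <- s) F i q : R^o) by exact: H.
elim: s => [|i s IH].
  by under eq_fun do rewrite big_nil; exact: smooth_near_cst.
by under eq_fun do rewrite big_cons; exact: smooth_nearM.
Qed.

Lemma smooth_near_continuous p f : smooth_near p f -> {for p, continuous f}.
Proof.
move=> [U [oU Up] sf]; pose c := chart_at p.
have cp : cdom c p := chart_at_dom p.
have ac : atlas c := chart_at_atlas p.
have cf := Ck_continuous (sf c ac 0%N) (chart_cod cp Up).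
have h : {for p, continuous (fun q => (f \o cinv c) (c q))}.
  by apply: continuous_comp; [exact: cmap_continuous|exact: cf].
apply: near_eq_continuous h; near=> q.
by rewrite /= cmapK //; near: q; apply: open_nbhs_nbhs; split=> //; exact: cdom_open.
Unshelve. all: by end_near. Qed.

Lemma smooth_near_neq0 p f : smooth_near p f -> f p != 0 -> \forall q \near p, f q != 0.
Proof.
move=> /smooth_near_continuous cf f0.
exact: (cf _ (open_nbhs_nbhs (conj (@open_neq _ 0) f0))).
Qed.

Lemma smooth_nearV p f : smooth_near p f -> f p != 0 ->
  smooth_near p (fun q => (f q)^-1 : R^o).
Proof.
move=> sf f0; have := smooth_near_neq0 sf f0.
rewrite /prop_near1 nbhsE => -[V [oV Vp] fV].
have [U [oU Up] sU] := sf; exists (U `&` V); first by split=> //; exact: openI.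
move=> c ac k; apply: Ck_inv; first by apply: chart_open; exact: openI.
  by move=> y [_ [_ Vy]]; exact: fV.
by apply: Ck_sub (sU c ac k) => y [cy []].
Qed.

Lemma smooth_near_coord p j : smooth_near p (chart_coord (chart_at p) j).
Proof.
exists (cdom (chart_at p)); last exact: smooth_on_coord (chart_at_atlas p).
by split; [exact: cdom_open|exact: chart_at_dom].
Qed.

Lemma near_cdom c p : cdom c p -> \forall q \near p, cdom c q.
Proof. by move=> cp; apply: open_nbhs_nbhs; split=> //; exact: cdom_open. Qed.

Arguments smooth_on_coord {c} j.

Section Directional.
Context {p : M}.

Lemma smooth_rep c f : atlas c -> cdom c p -> smooth_near p f ->
  exists2 V, open V /\ V (c p) & Cinfty V (f \o cinv c).
Proof.
move=> ac cp [U [oU Up] sf].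
exists (ccod c `&` cinv c @^-1` U); last by move=> k; exact: sf.
by split; [exact: chart_open|exact: chart_cod].
Qed.

Lemma derivable_rep c f v : atlas c -> cdom c p -> smooth_near p f ->
  derivable (f \o cinv c) (c p) v.
Proof.
by move=> ac cp /(smooth_rep ac cp)[V [oV Vp] sf]; exact: (Ck_derivable v (sf 1%N)).
Qed.

Arguments derivable_rep {c f} v.

Lemma dirder_near {W : normedModType R} (f g : M -> W) v :
  {near p, f =1 g} -> dirder f p v = dirder g p v.
Proof.
move=> fg; apply: near_eq_derive.
exact: (chart_near (chart_at_dom p) fg).
Qed.

Lemma dirderDv f u v : smooth_near p f ->
  dirder f p (u + v) = dirder f p u + dirder f p v.
Proof.
move=> /(smooth_rep (chart_at_atlas p) (chart_at_dom p))[V [oV Vp] sf].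
exact: deriveDv oV (sf 1%N) Vp.
Qed.

Lemma dirderZv f (a : R) v : smooth_near p f ->
  dirder f p (a *: v) = a * dirder f p v.
Proof.
move=> sf; apply: (derivableZv a _).2.
exact: derivable_rep (chart_at_atlas p) (chart_at_dom p) sf.
Qed.

Lemma dirderNv f v : smooth_near p f -> dirder f p (- v) = - dirder f p v.
Proof. by move=> sf; rewrite -scaleN1r dirderZv // mulN1r. Qed.

Lemma dirder_cst (a : R) v : dirder (fun=> a : R^o) p v = 0.
Proof. exact: derive_cst. Qed.

Lemma dirderD f g v : smooth_near p f -> smooth_near p g ->
  dirder (fun q => f q + g q : R^o) p v = dirder f p v + dirder g p v.
Proof.
move=> sf sg; rewrite /dirder.
have cp := chart_at_dom p; have ac := chart_at_atlas p.
exact: deriveD (derivable_rep v ac cp sf) (derivable_rep v ac cp sg).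
Qed.

Lemma dirderM f g v : smooth_near p f -> smooth_near p g ->
  dirder (fun q => f q * g q : R^o) p v = f p * dirder g p v + g p * dirder f p v.
Proof.
move=> sf sg; rewrite /dirder.
have cp := chart_at_dom p; have ac := chart_at_atlas p.
have := deriveM (derivable_rep v ac cp sf) (derivable_rep v ac cp sg).
by rewrite /= !cmapK.
Qed.

Lemma dirder_sum (I : finType) (F : I -> M -> R^o) v :
  (forall i, smooth_near p (F i)) ->
  dirder (fun q => \sum_i F i q : R^o) p v = \sum_i dirder (F i) p v.
Proof.
move=> sF.
suff H s : smooth_near p (fun q => \sum_(i <- s) F i q : R^o) /\
    dirder (fun q => \sum_(i <- s) F i q : R^o) p v = \sum_(i <- s) dirder (F i) p v.
  by case: (H (index_enum I)).
elim: s => [|i s [sS IH]].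
  under eq_fun do rewrite big_nil; rewrite big_nil.
  by split; [exact: smooth_near_cst|exact: dirder_cst].
under eq_fun do rewrite big_cons; rewrite big_cons -IH.
by split; [exact: smooth_nearD|exact: dirderD].
Qed.

Lemma dirder_sumv f (I : finType) (a : I -> R) (u : I -> 'rV[R]_n) :
  smooth_near p f ->
  dirder f p (\sum_i a i *: u i) = \sum_i a i * dirder f p (u i).
Proof.
move=> /(smooth_rep (chart_at_atlas p) (chart_at_dom p))[V [oV Vp] sf].
exact: derive_sumv oV (sf 1%N) Vp.
Qed.

Lemma dirder_row c v j : atlas c -> cdom c p ->
  dirder c p v 0 j = dirder (chart_coord c j) p v.
Proof.
move=> ac cp; rewrite -derive_row //.
apply: (Ck_derivable v (atlas_compatible (chart_at_atlas p) ac 1%N)).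
by apply: chart_cod => //; exact: chart_at_dom.
Qed.

(** This is the chain rule for the transition from [chart_at p] to [c]: in [c] the vector [v] has
    components [dirder c p v]. *)
Lemma dirder_chart c f v : atlas c -> cdom c p -> smooth_near p f ->
  dirder f p v = 'D_(dirder c p v) (f \o cinv c) (c p).
Proof.
move=> ac cp sf; have cpp := chart_at_dom p.
have [V [oV Vp] sV] := smooth_rep ac cp sf.
set g := c \o cinv (chart_at p).
have gp : g (chart_at p p) = c p by rewrite /g /= cmapK.
have dg : derivable g (chart_at p p) v.
  apply: (Ck_derivable v (atlas_compatible (chart_at_atlas p) ac 1%N)).
  by apply: chart_cod => //; exact: chart_at_dom.
have [|_ D] := derive_comp oV (sV 1%N) _ dg; first by rewrite gp.
rewrite gp in D; rewrite -D; apply: near_eq_derive.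
have := chart_near cpp (near_cdom cp).
by apply: filterS => y cy; rewrite /g /= cmapK.
Qed.

Lemma dirder_coords c f v : atlas c -> cdom c p -> smooth_near p f ->
  dirder f p v =
  \sum_j dirder (chart_coord c j) p v * 'D_(delta_mx 0 j) (f \o cinv c) (c p).
Proof.
move=> ac cp sf; rewrite (dirder_chart _ ac cp sf).
have [V [oV Vp] sV] := smooth_rep ac cp sf.
rewrite (derive_coords _ oV (sV 1%N) Vp).
by apply: eq_bigr => j _; rewrite dirder_row.
Qed.

Lemma derive_chart_coord c w j : cdom c p ->
  'D_w (chart_coord c j \o cinv c) (c p) = w 0 j.
Proof.
move=> cp; rewrite -[w in RHS](derive_id (c p) w) -derive_row; last exact: derivable_id.
apply: near_eq_derive; have : \forall y \near c p, ccod c y.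
  by apply: open_nbhs_nbhs; split; [exact: ccod_open|exact: cmap_cod].
by apply: filterS => y cy; rewrite /= /chart_coord cinvK.
Qed.

Lemma dirder_chart_at v j : dirder (chart_coord (chart_at p) j) p v = v 0 j.
Proof. exact: derive_chart_coord (chart_at_dom p). Qed.

(** Coordinate functions already separate tangent vectors. Identities between vectors can thus be
    tested on functions, without a change of chart. *)
Lemma dirder_inj u v : (forall f, smooth_near p f -> dirder f p u = dirder f p v) -> u = v.
Proof.
move=> H; apply/rowP => j; rewrite -!dirder_chart_at.
by apply: H; exact: smooth_near_coord.
Qed.

End Directional.

(** The coordinate field of [c] in the direction [w]. Its value at [q] has to be given in the
    components of [chart_at q], hence the derivative of that chart read in [c]. *)
Definition chart_frame c (w : 'rV[R]_n) : vfield M :=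
  fun q => 'D_w (chart_at q \o cinv c) (c q).

Lemma dirder_frame c f q w : atlas c -> cdom c q -> smooth_near q f ->
  dirder f q (chart_frame c w q) = 'D_w (f \o cinv c) (c q).
Proof.
move=> ac cq sf; have cqq := chart_at_dom q.
have [V [oV Vq] sV] := smooth_rep (chart_at_atlas q) cqq sf.
set g := chart_at q \o cinv c.
have gq : g (c q) = chart_at q q by rewrite /g /= cmapK.
have dg : derivable g (c q) w.
  apply: (Ck_derivable w (atlas_compatible ac (chart_at_atlas q) 1%N)).
  by apply: chart_cod => //; exact: chart_at_dom.
have [|_ D] := derive_comp oV (sV 1%N) _ dg; first by rewrite gq.
rewrite gq in D; rewrite /dirder /chart_frame -D; apply: near_eq_derive.
have := chart_near cq (near_cdom cqq).
by apply: filterS => y cy; rewrite /g /= cmapK.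
Qed.

Lemma frame_expansion c q v : atlas c -> cdom c q ->
  v = \sum_j dirder (chart_coord c j) q v *: chart_frame c (delta_mx 0 j) q.
Proof.
move=> ac cq; apply: (@dirder_inj q) => f sf; rewrite dirder_sumv //.
rewrite (dirder_coords _ ac cq sf); apply: eq_bigr => j _.
by rewrite dirder_frame.
Qed.

Lemma smooth_near_fin p (I : finType) (F : I -> M -> R^o) :
  (forall i, smooth_near p (F i)) ->
  exists2 U, open_nbhs p U & forall i, smooth_on U (F i).
Proof.
move=> sF.
suff [U pU H] : exists2 U, open_nbhs p U &
    forall i, i \in index_enum I -> smooth_on U (F i).
  by exists U => // i; apply: H; exact: mem_index_enum.
elim: (index_enum I) => [|i s [U [oU Up] IH]].
  by exists setT => //; split=> //; exact: openT.
have [V [oV Vp] sV] := sF i; exists (U `&` V); first by split=> //; exact: openI.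
move=> j; rewrite inE => /orP[/eqP->|/IH sj].
  by apply: smooth_on_sub sV => q [].
by apply: smooth_on_sub sj => q [].
Qed.

(** Lets sums, multiples and brackets of fields be handled as derivations of functions. For the
    converse the coordinates of one chart suffice: the components in any other chart combine their
    derivatives, with partial derivatives of the transition map as coefficients. *)
Lemma smooth_vfieldP p X : smooth_vfield_near p X <->
  forall f, smooth_near p f -> smooth_near p (fun q => dirder f q (X q) : R^o).
Proof.
pose c := chart_at p.
have cp : cdom c p := chart_at_dom p; have ac : atlas c := chart_at_atlas p.
split=> [[U [oU Up] sX] f [V [oV Vp] sf]|H].
  pose O := U `&` cdom c `&` V.
  have oO : open O by apply: openI => //; apply: openI => //; exact: cdom_open.
  have oUc : open (U `&` cdom c) by apply: openI => //; exact: cdom_open.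
  have S : smooth_near p (fun q => \sum_j (Defs.coord c X q 0 j : R^o) *
      'D_(delta_mx 0 j) (f \o cinv c) (c q) : R^o).
    apply: smooth_near_sum => j; apply: smooth_nearM.
      exists (U `&` cdom c) => //.
      by have /(smooth_on_row _ oUc) := sX c ac; exact.
    exists O => //; apply: smooth_on_partial => // [q [[]]//|].
    by apply: smooth_on_sub sf => q [].
  apply: smooth_near_eq S.
  have Op : O p by [].
  have : \forall q \near p, O q by apply: open_nbhs_nbhs.
  apply: filterS => q [[_ cq] Vq]; rewrite (dirder_coords _ ac cq); last by exists V.
  by apply: eq_bigr => j _; rewrite dirder_row.
have [U' [oU' Up'] sU'] := smooth_near_fin (fun j => H _ (smooth_near_coord p j)).
pose U := U' `&` cdom c.
have oU : open U by apply: openI => //; exact: cdom_open.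
exists U => // d ad.
have oUd : open (U `&` cdom d) by apply: openI => //; exact: cdom_open.
apply/smooth_on_row => // i.
suff S : smooth_on (U `&` cdom d) (fun q => \sum_j
    dirder (chart_coord c j) q (X q) *
      'D_(delta_mx 0 j) (chart_coord d i \o cinv c) (c q) : R^o).
  apply: smooth_on_eq oUd _ S => q [[_ cq] dq].
  rewrite -dirder_coords //; first by rewrite -dirder_row.
  by exists (cdom d); [split=> //; exact: cdom_open|exact: smooth_on_coord].
move=> e ae k; apply: Ck_sum; first exact: chart_open.
move=> j; apply: Ck_mul; first exact: chart_open.
  by apply: (Ck_sub _ (sU' j e ae k)) => y [ey [[U'y _] _]].
have := @smooth_on_partial c (U `&` cdom d) (chart_coord d i) (delta_mx 0 j) ac oUd.
move=> /(_ (fun q h => h.1.2)) sp; apply: sp => //.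
by apply: smooth_on_sub (smooth_on_coord i ad) => q [].
Qed.

End Manifold.

Arguments chart_open {R n M} c {U}.
Arguments smooth_on_coord {R n M c} j.
Arguments derivable_rep {R n M p c f} v.
Arguments smooth_near_cst {R n M} p a.

Lemma near_and {T : topologicalType} (p : T) (P Q : T -> Prop) :
  (\forall q \near p, P q) -> (\forall q \near p, Q q) ->
  \forall q \near p, P q /\ Q q.
Proof. exact: filterI. Qed.

Lemma near_near {T : topologicalType} (p : T) (P : T -> Prop) :
  (\forall q \near p, P q) -> \forall q \near p, \forall r \near q, P r.
Proof. exact: nbhs_interior. Qed.

(** * Smooth vector fields, the bracket as a commutator, and tensoriality *)

Section VectorFields.
Context {R : realType} {n : nat} {M : manifold R n}.
Implicit Types (c d : chart R n M) (p q : M) (f g : M -> R^o) (U V : set M).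
Implicit Types (u v w : 'rV[R]_n) (X Y Z : vfield M).

Lemma smooth_vfield_nbhs p X :
  smooth_vfield_near p X -> \forall q \near p, smooth_vfield_near q X.
Proof.
move=> [U [oU Up] sX]; near=> q; exists U => //; split=> //.
by near: q; exact: open_nbhs_nbhs.
Unshelve. all: by end_near. Qed.

Lemma smooth_vfield_eq p X Y : {near p, X =1 Y} ->
  smooth_vfield_near p X -> smooth_vfield_near p Y.
Proof.
move=> XY /smooth_vfieldP sX; apply/smooth_vfieldP => f /sX.
by apply: smooth_near_eq; apply: filterS XY => q ->.
Qed.

Lemma smooth_vfieldD p X Y : smooth_vfield_near p X -> smooth_vfield_near p Y ->
  smooth_vfield_near p (fun q => X q + Y q).
Proof.
move=> /smooth_vfieldP sX /smooth_vfieldP sY; apply/smooth_vfieldP => f sf.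
apply: smooth_near_eq (smooth_nearD (sX f sf) (sY f sf)).
by apply: filterS (smooth_near_nbhs sf) => q sq; rewrite dirderDv.
Qed.

Lemma smooth_vfieldZ p f X : smooth_near p f -> smooth_vfield_near p X ->
  smooth_vfield_near p (fun q => f q *: X q).
Proof.
move=> sf /smooth_vfieldP sX; apply/smooth_vfieldP => h sh.
apply: smooth_near_eq (smooth_nearM sf (sX h sh)).
by apply: filterS (smooth_near_nbhs sh) => q sq; rewrite dirderZv.
Qed.

Lemma smooth_vfieldN p X : smooth_vfield_near p X ->
  smooth_vfield_near p (fun q => - X q).
Proof.
move=> sX; rewrite (_ : (fun _ => _) = fun q => (-1 : R^o) *: X q).
  exact: smooth_vfieldZ (smooth_near_cst p _) sX.
by apply/funext => q; rewrite scaleN1r.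
Qed.

Lemma smooth_vfieldB p X Y : smooth_vfield_near p X -> smooth_vfield_near p Y ->
  smooth_vfield_near p (fun q => X q - Y q).
Proof. by move=> sX /smooth_vfieldN; exact: smooth_vfieldD. Qed.

Lemma smooth_vfield0 p : smooth_vfield_near p (fun=> 0 : 'rV[R]_n).
Proof.
apply/smooth_vfieldP => f sf; apply: smooth_near_eq (smooth_near_cst p 0).
by near=> q; rewrite /dirder derive0.
Unshelve. all: by end_near. Qed.

Lemma smooth_vfield_sum p (I : finType) (F : I -> vfield M) :
  (forall i, smooth_vfield_near p (F i)) ->
  smooth_vfield_near p (fun q => \sum_i F i q).
Proof.
move=> sF; suff H s : smooth_vfield_near p (fun q => \sum_(i <- s) F i q) by exact: H.
elim: s => [|i s IH].
  rewrite (_ : (fun _ => _) = fun=> 0); first exact: smooth_vfield0.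
  by apply/funext => q; rewrite big_nil.
rewrite (_ : (fun _ => _) = fun q => F i q + \sum_(i <- s) F i q).
  exact: (smooth_vfieldD (sF i) IH).
by apply/funext => q; rewrite big_cons.
Qed.

Lemma smooth_near_dirder p f X : smooth_near p f -> smooth_vfield_near p X ->
  smooth_near p (fun q => dirder f q (X q) : R^o).
Proof. by move=> sf /smooth_vfieldP; exact. Qed.

Lemma smooth_vfield_frame c p w : atlas c -> cdom c p ->
  smooth_vfield_near p (chart_frame c w).
Proof.
move=> ac cp; apply/smooth_vfieldP => f [U [oU Up] sf].
have oO : open (U `&` cdom c) by apply: openI => //; exact: cdom_open.
exists (U `&` cdom c) => //.
have S : smooth_on (U `&` cdom c) (fun q => 'D_w (f \o cinv c) (c q) : R^o).
  apply: smooth_on_partial => //.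
  by apply: smooth_on_sub sf => q [].
apply: smooth_on_eq oO _ S => q [Uq cq].
by rewrite dirder_frame //; exists U.
Qed.

(** In the chart at [p], X (Y f) - Y (X f) has a part with second derivatives of [f], which cancels
    by symmetry, and a part with first derivatives, whose coefficients are the components that
    define [bracket]. *)
Lemma dirder_bracket p f X Y : smooth_near p f -> smooth_vfield_near p X ->
  smooth_vfield_near p Y ->
  dirder f p (bracket X Y p) =
  dirder (fun q => dirder f q (Y q) : R^o) p (X p) -
  dirder (fun q => dirder f q (X q) : R^o) p (Y p).
Proof.
move=> sf sX sY; pose c := chart_at p.
have cp : cdom c p := chart_at_dom p; have ac : atlas c := chart_at_atlas p.
pose x j := chart_coord c j.
have sx j : smooth_near p (x j) := smooth_near_coord p j.
pose df j : M -> R^o := fun q => 'D_(delta_mx 0 j) (f \o cinv c) (c q).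
have sdf j : smooth_near p (df j).
  have [U [oU Up] sU] := sf.
  have oO : open (U `&` cdom c) by apply: openI => //; exact: cdom_open.
  exists (U `&` cdom c) => //; apply: smooth_on_partial => //.
  by apply: smooth_on_sub sU => q [].
have [V [oV Vp] sV] := smooth_rep ac cp sf.
have D Z u : smooth_vfield_near p Z ->
    dirder (fun q => dirder f q (Z q) : R^o) p u =
    \sum_j dirder (fun q => dirder (x j) q (Z q) : R^o) p u * df j p +
    \sum_j \sum_k Z p 0 j * u 0 k *
      'D_(delta_mx 0 k) ('D_(delta_mx 0 j) (f \o cinv c)) (c p).
  move=> sZ.
  rewrite (@dirder_near _ _ _ p _ _ (fun q => \sum_j dirder (x j) q (Z q) * df j q : R^o)).
    rewrite dirder_sum => [|j]; last by apply: smooth_nearM => //; exact: smooth_near_dirder.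
    rewrite -big_split; apply: eq_bigr => j _ /=.
    rewrite dirderM //; last exact: smooth_near_dirder.
    rewrite addrC [df j p * _]mulrC dirder_chart_at; congr (_ + _).
    rewrite {1}/dirder -/c.
    have -> : 'D_u (df j \o cinv c) (c p) = 'D_u ('D_(delta_mx 0 j) (f \o cinv c)) (c p).
      apply: near_eq_derive; have : \forall y \near c p, ccod c y.
        by apply: open_nbhs_nbhs; split; [exact: ccod_open|exact: cmap_cod].
      by apply: filterS => y cy; rewrite /df /= cinvK.
    rewrite (derive_coords _ oV (Ck_derive _ (sV 2%N)) Vp) mulr_sumr.
    by apply: eq_bigr => k _; rewrite mulrA.
  have := near_and (near_cdom cp) (smooth_near_nbhs sf).
  by apply: filterS => q [cq sq]; rewrite (dirder_coords _ ac cq sq).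
rewrite (D _ _ sX) (D _ _ sY) opprD addrACA -sumrB.
rewrite (exchange_big _ _ _ _ _ (fun j k : 'I_n => X p 0 j * Y p 0 k * _)) /=.
rewrite -[X in _ + X]sumrB [X in _ + X]big1 ?addr0 => [|j _]; last first.
  rewrite -sumrB big1 // => k _.
  by rewrite (derive_symmetric _ _ oV (sV 2%N) Vp) [X p 0 k * _]mulrC subrr.
rewrite [LHS](derive_coords _ oV (sV 1%N) Vp); apply: eq_bigr => j _.
rewrite -mulrBl; congr (_ * _).
have dc Z u : smooth_vfield_near p Z ->
    dirder (Defs.coord c Z) p u 0 j = dirder (fun q => dirder (x j) q (Z q) : R^o) p u.
  move=> [U [oU Up] sZ].
  have oO : open (U `&` cdom c) by apply: openI => //; exact: cdom_open.
  rewrite /dirder -derive_row.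
    apply: near_eq_derive; have := chart_near cp (near_cdom cp).
    by apply: filterS => y cy; rewrite /= /Defs.coord dirder_row.
  have := sZ c ac c ac 1%N => h; apply: (Ck_derivable u h).
  by apply: chart_cod.
transitivity (dirder (Defs.coord c Y) p (X p) 0 j - dirder (Defs.coord c X) p (Y p) 0 j).
  by rewrite /bracket [LHS]mxE [X in _ + X]mxE.
by congr (_ - _); exact: dc.
Qed.

Lemma smooth_vfield_bracket p X Y : smooth_vfield_near p X -> smooth_vfield_near p Y ->
  smooth_vfield_near p (bracket X Y).
Proof.
move=> sX sY; apply/smooth_vfieldP => f sf.
have S := smooth_nearB (smooth_near_dirder (smooth_near_dirder sf sY) sX)
  (smooth_near_dirder (smooth_near_dirder sf sX) sY).
apply: smooth_near_eq S.
have := near_and (smooth_near_nbhs sf)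
  (near_and (smooth_vfield_nbhs sX) (smooth_vfield_nbhs sY)).
by apply: filterS => q [sfq [sXq sYq]]; rewrite dirder_bracket.
Qed.

(** Prepares the tensoriality argument: a field that is zero at [p] gets coefficients that are zero
    at [p]. The expansion holds on the domain of one chart only, hence merely near [p]. *)
Lemma vfield_expansion p X : smooth_vfield_near p X ->
  exists a : 'I_n -> M -> R^o, exists e : 'I_n -> vfield M,
  [/\ forall j, smooth_near p (a j), forall j, smooth_vfield_near p (e j),
      forall j, X p = 0 -> a j p = 0 &
      \forall q \near p, X q = \sum_j a j q *: e j q].
Proof.
move=> sX; pose c := chart_at p.
have cp : cdom c p := chart_at_dom p; have ac : atlas c := chart_at_atlas p.
exists (fun j q => dirder (chart_coord c j) q (X q)).
exists (fun j => chart_frame c (delta_mx 0 j)); split.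
- by move=> j; apply: smooth_near_dirder => //; exact: smooth_near_coord.
- by move=> j; exact: smooth_vfield_frame.
- by move=> j ->; rewrite /dirder derive0.
- by apply: filterS (near_cdom cp) => q cq; exact: frame_expansion.
Qed.

(* Stands in for a cut-off function: f need only be smooth near p, so it may jump
   where X starts to be nonzero. *)
Lemma vfield_absorb p X : (\forall q \near p, X q = 0) ->
  exists f, [/\ smooth_near p f, f p = 0 & X = fun q => f q *: X q].
Proof.
move=> X0; exists (fun q => if X q == 0 then 0 else 1); split.
- apply: smooth_near_eq (smooth_near_cst p 0).
  by apply: filterS X0 => q ->; rewrite eqxx.
- by rewrite (nbhs_singleton X0) eqxx.
- by apply/funext => q; case: eqP => [->|_]; rewrite ?scaler0 ?scale1r.
Qed.

Section Tensorial.
Context {p : M} {W : lmodType R} (L : vfield M -> W).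
Hypothesis LD : forall X Y, smooth_vfield_near p X -> smooth_vfield_near p Y ->
  L (fun q => X q + Y q) = L X + L Y.
Hypothesis LZ : forall f X, smooth_near p f -> smooth_vfield_near p X ->
  L (fun q => f q *: X q) = f p *: L X.

Lemma tensorial_sum (I : finType) (a : I -> M -> R^o) (e : I -> vfield M) :
  (forall i, smooth_near p (a i)) -> (forall i, smooth_vfield_near p (e i)) ->
  L (fun q => \sum_i a i q *: e i q) = \sum_i a i p *: L (e i).
Proof.
move=> sa se.
suff H s : smooth_vfield_near p (fun q => \sum_(i <- s) a i q *: e i q) /\
    L (fun q => \sum_(i <- s) a i q *: e i q) = \sum_(i <- s) a i p *: L (e i).
  by case: (H (index_enum I)).
elim: s => [|i s [sS IH]].
  rewrite (_ : (fun _ => _) = fun=> 0); last by apply/funext => q; rewrite big_nil.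
  rewrite big_nil; split; first exact: smooth_vfield0.
  have := LZ (smooth_near_cst p 0) (smooth_vfield0 p).
  by under eq_fun do rewrite scaler0; rewrite scale0r.
rewrite (_ : (fun _ => _) = fun q => a i q *: e i q + \sum_(i <- s) a i q *: e i q);
  last by apply/funext => q; rewrite big_cons.
rewrite big_cons -IH.
have sZ := smooth_vfieldZ (sa i) (se i).
by split; [exact: (smooth_vfieldD sZ sS)|rewrite (LD sZ sS) (LZ (sa i) (se i))].
Qed.

(** The difference [D] is zero at [p]. Split it as [E], whose coefficients vanish at [p], plus a
    remainder that is zero near [p] and is absorbed by a factor [f] with [f p = 0]; [L] kills
    both. *)
Lemma tensorial X Y : smooth_vfield_near p X -> smooth_vfield_near p Y ->
  X p = Y p -> L X = L Y.
Proof.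
move=> sX sY XY; pose D : vfield M := fun q => X q - Y q.
have sD : smooth_vfield_near p D by exact: (smooth_vfieldB sX sY).
have Dp : D p = 0 by rewrite /D XY subrr.
have [a [e [sa se a0 De]]] := vfield_expansion sD.
pose E : vfield M := fun q => \sum_j a j q *: e j q.
have sE : smooth_vfield_near p E.
  exact: (smooth_vfield_sum (fun j => smooth_vfieldZ (sa j) (se j))).
have sDE := smooth_vfieldB sD sE.
have [f [sf f0 fE]] : exists f, [/\ smooth_near p f, f p = 0 &
    (fun q => D q - E q) = fun q => f q *: (D q - E q)].
  by apply: vfield_absorb; apply: filterS De => q ->; rewrite subrr.
have LDE : L (fun q => D q - E q) = 0 by rewrite fE LZ // f0 scale0r.
have LE : L E = 0.
  by rewrite [LHS](tensorial_sum sa se) big1 // => j _; rewrite a0 // scale0r.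
have -> : X = fun q => Y q + (E q + (D q - E q)).
  by apply/funext => q; rewrite subrKC /D addrC subrK.
have sEDE := smooth_vfieldD sE sDE.
by rewrite (LD sY sEDE) (LD sE sDE) LE LDE !addr0.
Qed.

End Tensorial.

Lemma smooth_near_det p k (A : M -> 'M[R]_k) :
  (forall i j, smooth_near p (fun q => A q i j : R^o)) ->
  smooth_near p (fun q => \det (A q) : R^o).
Proof.
move=> sA; apply: smooth_near_sum => s.
apply: smooth_nearM; first exact: smooth_near_cst.
by apply: smooth_near_prod => i.
Qed.

(** Cramer's rule: the entries are cofactors over the determinant, which stays nonzero near [p]. *)
Lemma smooth_near_invmx p k (A : M -> 'M[R]_k) :
  (forall i j, smooth_near p (fun q => A q i j : R^o)) -> A p \in unitmx ->
  forall i j, smooth_near p (fun q => invmx (A q) i j : R^o).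
Proof.
move=> sA uA i j; have sdet := smooth_near_det sA.
have det0 : \det (A p) != 0 by rewrite -unitfE.
have S : smooth_near p (fun q => (\det (A q))^-1 *
    ((-1) ^+ (j + i) * \det (row' j (col' i (A q)))) : R^o).
  apply: smooth_nearM; first exact: smooth_nearV.
  apply: smooth_nearM; first exact: smooth_near_cst.
  by apply: smooth_near_det => k1 k2; under eq_fun do rewrite !mxE; exact: sA.
apply: smooth_near_eq S.
apply: filterS (smooth_near_neq0 sdet det0) => q dq.
by rewrite /invmx unitmxE unitfE dq !mxE.
Qed.

(** * Riemannian metrics, Gram matrices and gradients *)

Section Metric.
Variable (g : bilinear_form M).
Hypothesis hg : riemannian_metric g.

Lemma metricDl p u v w : g p (u + v) w = g p u w + g p v w.
Proof. by rewrite -[u in LHS]scale1r (metric_linear hg) mul1r. Qed.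

Lemma metric0l p w : g p 0 w = 0.
Proof. by apply: (addrI (g p 0 w)); rewrite -metricDl !addr0. Qed.

Lemma metricZl p (a : R) u w : g p (a *: u) w = a * g p u w.
Proof. by rewrite -[a *: u]addr0 (metric_linear hg) metric0l addr0. Qed.

Lemma metricNl p u w : g p (- u) w = - g p u w.
Proof. by rewrite -scaleN1r metricZl mulN1r. Qed.

Lemma metricBl p u v w : g p (u - v) w = g p u w - g p v w.
Proof. by rewrite metricDl metricNl. Qed.

Lemma metricC p u v : g p u v = g p v u.
Proof. exact: (Defs.metric_sym hg). Qed.

Lemma metricDr p u v w : g p w (u + v) = g p w u + g p w v.
Proof. by rewrite metricC metricDl !(metricC p w). Qed.

Lemma metric0r p w : g p w 0 = 0.
Proof. by rewrite metricC metric0l. Qed.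

Lemma metricZr p (a : R) u w : g p w (a *: u) = a * g p w u.
Proof. by rewrite metricC metricZl metricC. Qed.

Lemma metricNr p u w : g p w (- u) = - g p w u.
Proof. by rewrite metricC metricNl metricC. Qed.

Lemma metricBr p u v w : g p w (u - v) = g p w u - g p w v.
Proof. by rewrite metricDr metricNr. Qed.

Lemma metric_suml p (I : finType) (F : I -> 'rV[R]_n) w :
  g p (\sum_i F i) w = \sum_i g p (F i) w.
Proof. by apply: (big_morph (fun u => g p u w)) => [u v|]; [exact: metricDl|exact: metric0l]. Qed.

Lemma metric_sumr p (I : finType) (F : I -> 'rV[R]_n) w :
  g p w (\sum_i F i) = \sum_i g p w (F i).
Proof. by rewrite metricC metric_suml; apply: eq_bigr => i _; rewrite metricC. Qed.

Lemma metric_eq0 p v : g p v v = 0 -> v = 0.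
Proof.
move=> gv; apply/eqP; apply: contraT => /(metric_pos hg p).
by rewrite gv ltxx.
Qed.

Lemma metric_inj p u v : (forall w, g p u w = g p v w) -> u = v.
Proof.
move=> H; apply/eqP; rewrite -subr_eq0; apply/eqP/(@metric_eq0 p).
by rewrite metricBl H subrr.
Qed.

Lemma smooth_near_metric p X Y : smooth_vfield_near p X -> smooth_vfield_near p Y ->
  smooth_near p (fun q => g q (X q) (Y q) : R^o).
Proof. exact: (metric_smooth hg). Qed.

(** A row vector killed by the matrix gives a combination of the [e i] of length zero; positivity
    makes the combination vanish and independence then its coefficients. *)
Lemma gram_unit p k (e : 'I_k -> 'rV[R]_n) :
  (forall a : 'I_k -> R, \sum_i a i *: e i = 0 -> forall i, a i = 0) ->
  (\matrix_(i, j) g p (e i) (e j)) \in unitmx.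
Proof.
move=> free; rewrite -row_free_unit; apply: inj_row_free => v vA.
apply/rowP => i; rewrite mxE; apply: free => {i}.
apply: (@metric_eq0 p); rewrite [X in g p _ X](_ : _ = \sum_i v 0 i *: e i) //.
rewrite metric_sumr big1 // => j _; rewrite metricZr metric_suml.
move/rowP/(_ j): vA; rewrite !mxE => vA.
rewrite [X in _ * X](_ : _ = 0) ?mulr0 // -[RHS]vA.
by apply: eq_bigr => i _; rewrite metricZl mxE.
Qed.

Lemma gradient p f : smooth_near p f -> exists2 G : vfield M, smooth_vfield_near p G &
  \forall q \near p, forall v, g q (G q) v = dirder f q v.
Proof.
move=> sf; pose c := chart_at p.
have cp : cdom c p := chart_at_dom p; have ac : atlas c := chart_at_atlas p.
pose e j := chart_frame c (delta_mx 0 j).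
have se j : smooth_vfield_near p (e j) by exact: smooth_vfield_frame.
pose A q := \matrix_(i, j) g q (e i q) (e j q).
have uA q : cdom c q -> A q \in unitmx.
  (* The coordinate frame is independent: the derivative of the [i]-th coordinate function along the
     vanishing combination is [a i]. *)
  move=> cq; apply: gram_unit => a a0 i.
  have sx : smooth_near q (chart_coord c i).
    by exists (cdom c); [split=> //; exact: cdom_open|exact: smooth_on_coord].
  have := dirder_sumv a (fun j => e j q) sx; rewrite a0 {1}/dirder derive0.
  rewrite (bigD1 i) //= big1 => [|j ji].
    by rewrite dirder_frame // derive_chart_coord // mxE !eqxx mulr1 addr0.
  by rewrite dirder_frame // derive_chart_coord // mxE eqxx eq_sym (negbTE ji) mulr0.
have sA i j : smooth_near p (fun q => A q i j : R^o).
  by under eq_fun do rewrite mxE; exact: smooth_near_metric.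
have sAi := smooth_near_invmx sA (uA p cp).
(* The classical gradient: the metric with raised indices, contracted with the partial derivatives
   of [f]. *)
exists (fun q => \sum_j (\sum_i dirder f q (e i q) * invmx (A q) i j) *: e j q).
  apply: smooth_vfield_sum => j; apply: smooth_vfieldZ (se j).
  apply: smooth_near_sum => i; apply: smooth_nearM => //.
  exact: smooth_near_dirder.
have := near_and (near_cdom cp) (smooth_near_nbhs sf).
apply: filterS => q [cq sq] v.
rewrite (frame_expansion v ac cq) metric_sumr dirder_sumv //.
apply: eq_bigr => k _; rewrite metricZr; congr (_ * _).
rewrite metric_suml; under eq_bigr do rewrite metricZl mulr_suml.
rewrite exchange_big /= (bigD1 k) //= [X in _ + X]big1 ?addr0 => [|i ik].
- have := mulVmx (uA q cq) => /matrixP/(_ k k); rewrite !mxE eqxx => E.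
  transitivity (dirder f q (e k q) * \sum_j invmx (A q) k j * A q j k).
    by rewrite mulr_sumr; apply: eq_bigr => j _; rewrite [A q j k]mxE mulrA.
  by rewrite E mulr1.
- have := mulVmx (uA q cq) => /matrixP/(_ i k); rewrite !mxE (negbTE ik) => E.
  transitivity (dirder f q (e i q) * \sum_j invmx (A q) i j * A q j k).
    by rewrite mulr_sumr; apply: eq_bigr => j _; rewrite [A q j k]mxE mulrA.
  by rewrite E mulr0.
Qed.

End Metric.

End VectorFields.

(** * Riemannian submersions *)

Section Maps.
Context {R : realType} {m n : nat} {M : manifold R m} {N : manifold R n}.
Variable F : M -> N.
Hypothesis sF : smooth_map F.
Implicit Types (p q : M) (h : N -> R^o) (u v : 'rV[R]_m) (X Y V : vfield M).

Lemma open_map_preimage (d : chart R n N) (U : set N) : open U ->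
  open (F @^-1` (U `&` cdom d)).
Proof.
move=> oU; move: sF => [cF _]; move/continuousP: cF; apply.
by apply: openI => //; exact: cdom_open.
Qed.

Lemma smooth_near_comp p h : smooth_near (F p) h -> smooth_near p (h \o F : M -> R^o).
Proof.
move=> [U [oU Up] sh]; pose d := chart_at (F p).
have dp : cdom d (F p) := chart_at_dom (F p); have ad : atlas d := chart_at_atlas (F p).
have oP := open_map_preimage d oU.
exists (F @^-1` (U `&` cdom d)); first by split.
move=> c ac k; have oO := chart_open c oP.
have oV : open (ccod d `&` cinv d @^-1` (U `&` cdom d)).
  by apply: chart_open; apply: openI => //; exact: cdom_open.
have sG : Ck k (ccod c `&` cinv c @^-1` (F @^-1` (U `&` cdom d))) ((d \o F) \o cinv c).
  apply: Ck_sub (sF.2 d ad c ac k).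
  by move=> y [cy [Uy dy]].
have sH : Ck k (ccod d `&` cinv d @^-1` (U `&` cdom d)) (h \o cinv d).
  by apply: Ck_sub (sh d ad k) => y [cy [Uy dy]].
have GU y : (ccod c `&` cinv c @^-1` (F @^-1` (U `&` cdom d))) y ->
    (ccod d `&` cinv d @^-1` (U `&` cdom d)) (((d \o F) \o cinv c) y).
  by move=> [cy [Uy dy]]; apply: chart_cod.
apply: Ck_eq oO _ (Ck_comp oO oV GU sG sH) => y [cy [Uy dy]] /=.
by rewrite cmapK.
Qed.

Lemma dirder_pushforward p h v : smooth_near (F p) h ->
  dirder (h \o F : M -> R^o) p v = dirder h (F p) (Defs.pushforward F p v).
Proof.
move=> sh; pose d := chart_at (F p); pose c := chart_at p.
have dp : cdom d (F p) := chart_at_dom (F p); have ad : atlas d := chart_at_atlas (F p).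
have cp : cdom c p := chart_at_dom p; have ac : atlas c := chart_at_atlas p.
have [V [oV Vp] sV] := smooth_rep ad dp sh.
set g := (d \o F) \o cinv c.
have gp : g (c p) = d (F p) by rewrite /g /= cmapK.
have dg : derivable g (c p) v.
  apply: (Ck_derivable v (sF.2 d ad c ac 1%N)).
  by apply: chart_cod.
have [|_ D] := derive_comp oV (sV 1%N) _ dg; first by rewrite gp.
rewrite gp in D; rewrite [RHS]/dirder -/d.
rewrite [Defs.pushforward F p v](_ : _ = 'D_v g (c p)) // -D.
apply: near_eq_derive.
have oP := open_map_preimage d openT.
have nd : \forall q \near p, (F @^-1` (setT `&` cdom d)) q by apply: open_nbhs_nbhs.
by apply: filterS (chart_near cp nd) => y [_ dy]; rewrite /g /= cmapK.
Qed.

Lemma vertical_dirder p h v : smooth_near (F p) h -> vertical F p v ->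
  dirder (h \o F : M -> R^o) p v = 0.
Proof. by move=> sh vv; rewrite dirder_pushforward // vv /dirder derive0. Qed.

(** Functions pulled back from [N] detect vertical vectors; combinations and brackets of vertical
    fields can then be treated without coordinates. *)
Lemma verticalP p v : vertical F p v <->
  forall h, smooth_near (F p) h -> dirder (h \o F : M -> R^o) p v = 0.
Proof.
split=> [vv h sh|H]; first exact: vertical_dirder.
apply: (@dirder_inj _ _ _ (F p)) => h sh.
by rewrite -dirder_pushforward // H // /dirder derive0.
Qed.

Lemma verticalZD p (a : R) u v : vertical F p u -> vertical F p v ->
  vertical F p (a *: u + v).
Proof.
move=> /verticalP hu /verticalP hv; apply/verticalP => h sh.
have sc := smooth_near_comp sh.
by rewrite dirderDv // dirderZv // hu // hv // mulr0 addr0.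
Qed.

Lemma vertical0 p : vertical F p 0.
Proof. by apply/verticalP => h sh; rewrite /dirder derive0. Qed.

Lemma verticalD p u v : vertical F p u -> vertical F p v -> vertical F p (u + v).
Proof. by move=> hu; rewrite -[u]scale1r; exact: verticalZD. Qed.

Lemma verticalZ p (a : R) u : vertical F p u -> vertical F p (a *: u).
Proof. by move=> hu; rewrite -[_ *: _]addr0; exact: (verticalZD a hu (vertical0 p)). Qed.

Lemma verticalN p u : vertical F p u -> vertical F p (- u).
Proof. by rewrite -scaleN1r; exact: verticalZ. Qed.

Lemma verticalB p u v : vertical F p u -> vertical F p v -> vertical F p (u - v).
Proof. by move=> hu /verticalN; exact: verticalD. Qed.

Lemma near_map (P : set N) p : (\forall y \near F p, P y) -> \forall q \near p, P (F q).
Proof. by move=> nP; move: sF => [cF _]; exact: cF. Qed.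

Lemma dirder_comp_vertical0 p h V : smooth_near (F p) h ->
  (\forall q \near p, vertical F q (V q)) ->
  {near p, (fun q => dirder (h \o F : M -> R^o) q (V q) : R^o) =1 fun=> 0}.
Proof.
move=> sh vV.
have := near_and vV (near_map (smooth_near_nbhs sh)).
by apply: filterS => q [vq sq]; exact: vertical_dirder.
Qed.

Lemma bracket_vertical p V X : smooth_vfield_near p V -> smooth_vfield_near p X ->
  (\forall q \near p, vertical F q (V q)) -> (\forall q \near p, vertical F q (X q)) ->
  vertical F p (bracket V X p).
Proof.
move=> sV sX vV vX; apply/verticalP => h sh.
rewrite dirder_bracket //; last exact: smooth_near_comp.
rewrite (dirder_near _ (dirder_comp_vertical0 sh vV)).
rewrite (dirder_near _ (dirder_comp_vertical0 sh vX)).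
by rewrite !dirder_cst subrr.
Qed.

End Maps.

(** * Orthogonal projections of a submersion, and the metric along its fibres *)

Section Submersion.
Context {R : realType} {m n : nat} {M : manifold R m} {N : manifold R n}.
Context {F : M -> N} {gM : bilinear_form M} {gN : bilinear_form N}.
Hypotheses (hM : riemannian_metric gM) (hN : riemannian_metric gN).
Hypothesis hF : riemannian_submersion F gM gN.
Implicit Types (p q : M) (u v w : 'rV[R]_m) (X Y V : vfield M).

Let sF : smooth_map F := submersion_smooth hF.

(** A coordinate of [N] pulled back to [M]. The gradients of these functions are horizontal and span
    the horizontal spaces near [p]. *)
Definition base_coord p (i : 'I_n) : M -> R^o := chart_coord (chart_at (F p)) i \o F.

Lemma smooth_base_chart p q i : cdom (chart_at (F p)) (F q) ->
  smooth_near (F q) (chart_coord (chart_at (F p)) i).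
Proof.
move=> dq; exists (cdom (chart_at (F p))); first by split=> //; exact: cdom_open.
exact: smooth_on_coord (chart_at_atlas _).
Qed.

Lemma near_base_dom p : \forall q \near p, cdom (chart_at (F p)) (F q).
Proof.
apply: (near_map sF (P := cdom (chart_at (F p)))).
exact: near_cdom (chart_at_dom _).
Qed.

Lemma pushforward_expansion p q v : cdom (chart_at (F p)) (F q) ->
  Defs.pushforward F q v = \sum_i dirder (base_coord p i) q v *:
    chart_frame (chart_at (F p)) (delta_mx 0 i) (F q).
Proof.
move=> dq; rewrite [LHS](frame_expansion _ (chart_at_atlas (F p)) dq).
apply: eq_bigr => i _; congr (_ *: _); rewrite dirder_pushforward //.
exact: smooth_base_chart.
Qed.

Lemma horizontalZD p (a : R) u v : horizontal F gM p u -> horizontal F gM p v ->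
  horizontal F gM p (a *: u + v).
Proof. by move=> hu hv w vw; rewrite (metric_linear hM) hu // hv // mulr0 addr0. Qed.

Lemma horizontal0 p : horizontal F gM p 0.
Proof. by move=> w _; exact: metric0l. Qed.

Lemma horizontalD p u v : horizontal F gM p u -> horizontal F gM p v ->
  horizontal F gM p (u + v).
Proof. by move=> hu; rewrite -[u]scale1r; exact: horizontalZD. Qed.

Lemma horizontalZ p (a : R) u : horizontal F gM p u -> horizontal F gM p (a *: u).
Proof. by move=> hu; rewrite -[_ *: _]addr0; exact: (horizontalZD a hu (horizontal0 (p := p))). Qed.

Lemma horizontalN p u : horizontal F gM p u -> horizontal F gM p (- u).
Proof. by rewrite -scaleN1r; exact: horizontalZ. Qed.

Lemma horizontalB p u v : horizontal F gM p u -> horizontal F gM p v ->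
  horizontal F gM p (u - v).
Proof. by move=> hu /horizontalN; exact: horizontalD. Qed.

Lemma horizontal_gradients p : exists G : 'I_n -> vfield M,
  (forall i, smooth_vfield_near p (G i)) /\
  \forall q \near p, forall i v, gM q (G i q) v = dirder (base_coord p i) q v.
Proof.
have sb i : smooth_near p (base_coord p i).
  by apply: smooth_near_comp => //; apply: smooth_base_chart; exact: chart_at_dom.
have H i : exists G : vfield M, smooth_vfield_near p G /\
    \forall q \near p, forall v, gM q (G q) v = dirder (base_coord p i) q v.
  by have [G sG GP] := gradient hM (sb i); exists G.
have [G GP] := choice H; exists G; split=> [i|]; first by case: (GP i).
by apply: filter_forall => i; case: (GP i).
Qed.

(** [vproj] is chosen point by point, so the existence and the smoothness of the projection are both
    drawn from this field. It is a combination of the gradients of the base coordinates, with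
    coefficients solved from their Gram matrix. *)
Lemma exists_hfield p X : smooth_vfield_near p X ->
  exists2 H : vfield M, smooth_vfield_near p H &
    \forall q \near p, horizontal F gM q (H q) /\ vertical F q (X q - H q).
Proof.
move=> sX; have [G [sG GP]] := horizontal_gradients p.
have sb i : smooth_near p (base_coord p i).
  by apply: smooth_near_comp => //; apply: smooth_base_chart; exact: chart_at_dom.
pose B q := \matrix_(i, j) gM q (G i q) (G j q).
have uB q : cdom (chart_at (F p)) (F q) ->
    (forall i v, gM q (G i q) v = dirder (base_coord p i) q v) -> B q \in unitmx.
  move=> dq Gq; apply: gram_unit => // a a0 k.
  (* By the rank condition some [v] lies over the [k]-th coordinate vector; pairing the relation
     [a0] with it leaves [a k]. *)
  have [v vE] := submersion_rank hF q
    (chart_frame (chart_at (F p)) (delta_mx 0 k) (F q)).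
  have D j : dirder (base_coord p j) q v = (j == k)%:R.
    have sj := smooth_base_chart j dq.
    rewrite [LHS](dirder_pushforward sF v sj) vE.
    by rewrite (dirder_frame _ (chart_at_atlas _) dq sj) derive_chart_coord // mxE.
  have := metric0l hM q v; rewrite -a0 (metric_suml hM) (bigD1 k) //= big1 => [|j jk].
    by rewrite (metricZl hM) Gq D eqxx mulr1 addr0.
  by rewrite (metricZl hM) Gq D (negbTE jk) mulr0.
have sB i j : smooth_near p (fun q => B q i j : R^o).
  rewrite (_ : (fun q => B q i j) = fun q => gM q (G i q) (G j q)).
    exact: (smooth_near_metric hM (sG i) (sG j)).
  by apply/funext => q; rewrite mxE.
have uBp : B p \in unitmx.
  by apply: uB; [exact: chart_at_dom|exact: nbhs_singleton GP].
have sBi := smooth_near_invmx sB uBp.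
have nB := near_and (near_base_dom p) GP.
(* The coefficients for which the difference of [X] and the combination has zero derivative on every
   base coordinate, hence is vertical. *)
pose a j q := \sum_i dirder (base_coord p i) q (X q) * invmx (B q) i j.
have sa j : smooth_near p (a j : M -> R^o).
  apply: smooth_near_sum => i; apply: smooth_nearM => //.
  exact: smooth_near_dirder.
exists (fun q => \sum_j a j q *: G j q).
  exact: (smooth_vfield_sum (fun j => smooth_vfieldZ (sa j) (sG j))).
apply: filterS nB => q [dq Gq].
have sbq k : smooth_near q (base_coord p k).
  by apply: smooth_near_comp => //; exact: smooth_base_chart.
split=> [w vw|].
  rewrite metric_suml // big1 // => j _; rewrite metricZl // Gq.
  by rewrite vertical_dirder ?mulr0 //; exact: smooth_base_chart.
have D0 k : dirder (base_coord p k) q (X q - \sum_j a j q *: G j q) = 0.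
  rewrite dirderDv // dirderNv // dirder_sumv //.
  under eq_bigr do rewrite mulr_suml.
  rewrite exchange_big /= (bigD1 k) //= [X in _ - (_ + X)]big1 ?addr0 => [|i ik].
    have := mulVmx (uB q dq Gq) => /matrixP/(_ k k); rewrite !mxE eqxx => E.
    rewrite (eq_bigr (fun j => dirder (base_coord p k) q (X q) *
        (invmx (B q) k j * B q j k))) => [|j _].
      by rewrite -mulr_sumr E mulr1 subrr.
    by rewrite [B q j k]mxE -mulrA -(Gq k (G j q)) (metricC hM q (G k q)).
  have := mulVmx (uB q dq Gq) => /matrixP/(_ i k); rewrite !mxE (negbTE ik) => E.
  rewrite (eq_bigr (fun j => dirder (base_coord p i) q (X q) *
      (invmx (B q) i j * B q j k))) => [|j _].
    by rewrite -mulr_sumr E mulr0.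
  by rewrite [B q j k]mxE -mulrA -(Gq k (G j q)) (metricC hM q (G k q)).
rewrite /vertical (pushforward_expansion _ dq) big1 // => i _.
by rewrite D0 scale0r.
Qed.

Lemma vertical_horizontal0 p v : vertical F p v -> horizontal F gM p v -> v = 0.
Proof. by move=> vv /(_ v vv); exact: metric_eq0. Qed.

Lemma vprojE p v w : vertical F p w -> horizontal F gM p (v - w) ->
  vproj F gM p v = w.
Proof.
move=> vw hw; rewrite /vproj; apply: xget_unique => //= w' [vw' hw'].
apply/eqP; rewrite -subr_eq0; apply/eqP; apply: (@vertical_horizontal0 p).
  exact: verticalB.
rewrite (_ : w' - w = (v - w) - (v - w')); first exact: horizontalB.
by rewrite opprB [RHS]addrC subrKA.
Qed.

(** To apply [exists_hfield], [v] is extended to a field with constant coefficients in the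
    coordinate frame at [p]. *)
Lemma vproj_spec p v : vertical F p (vproj F gM p v) /\
  horizontal F gM p (v - vproj F gM p v).
Proof.
pose X : vfield M := fun q =>
  \sum_j v 0 j *: chart_frame (chart_at p) (delta_mx 0 j) q.
have sX : smooth_vfield_near p X.
  apply: smooth_vfield_sum => j.
  exact: (smooth_vfieldZ (smooth_near_cst p (v 0 j))
    (smooth_vfield_frame _ (chart_at_atlas p) (chart_at_dom p))).
have Xp : X p = v.
  rewrite [RHS](frame_expansion _ (chart_at_atlas p) (chart_at_dom p)).
  by apply: eq_bigr => j _; rewrite dirder_chart_at.
have [H sH /nbhs_singleton[hH vH]] := exists_hfield sX.
rewrite Xp in vH; have E : v - (v - H p) = H p by rewrite subKr.
by rewrite (vprojE vH) E.
Qed.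

Lemma vertical_vproj p v : vertical F p (vproj F gM p v).
Proof. exact: (vproj_spec p v).1. Qed.

Lemma horizontal_hproj p v : horizontal F gM p (hproj F gM p v).
Proof. exact: (vproj_spec p v).2. Qed.

Lemma vproj_vertical p v : vertical F p v -> vproj F gM p v = v.
Proof. by move=> vv; apply: vprojE => //; rewrite subrr; exact: horizontal0. Qed.

Lemma vproj_horizontal p v : horizontal F gM p v -> vproj F gM p v = 0.
Proof. by move=> hv; apply: vprojE; [exact: vertical0|rewrite subr0]. Qed.

Lemma hproj_vertical p v : vertical F p v -> hproj F gM p v = 0.
Proof. by move=> vv; rewrite /hproj vproj_vertical // subrr. Qed.

Lemma hproj_horizontal p v : horizontal F gM p v -> hproj F gM p v = v.
Proof. by move=> vv; rewrite /hproj vproj_horizontal // subr0. Qed.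

Lemma vprojZD p (a : R) u v :
  vproj F gM p (a *: u + v) = a *: vproj F gM p u + vproj F gM p v.
Proof.
have [vu hu] := vproj_spec p u; have [vv hv] := vproj_spec p v.
apply: vprojE; first exact: verticalZD.
by rewrite opprD addrACA -scalerBr; exact: horizontalZD.
Qed.

Lemma hprojZD p (a : R) u v :
  hproj F gM p (a *: u + v) = a *: hproj F gM p u + hproj F gM p v.
Proof. by rewrite /hproj vprojZD opprD addrACA -scalerBr. Qed.

Lemma vproj_hproj p v : v = vproj F gM p v + hproj F gM p v.
Proof. by rewrite /hproj addrC subrK. Qed.

Lemma smooth_vproj p X : smooth_vfield_near p X ->
  smooth_vfield_near p (app (vproj F gM) X).
Proof.
move=> sX; have [H sH HP] := exists_hfield sX.
apply: smooth_vfield_eq (smooth_vfieldB sX sH).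
apply: filterS HP => q [hH vH]; rewrite /app (vprojE vH) //.
by rewrite subKr.
Qed.

Lemma smooth_hproj p X : smooth_vfield_near p X ->
  smooth_vfield_near p (app (hproj F gM) X).
Proof. by move=> sX; exact: (smooth_vfieldB sX (smooth_vproj sX)). Qed.

(** Polarization, as the definition of a Riemannian submersion compares lengths only. *)
Lemma isometry_polar p u v : horizontal F gM p u -> horizontal F gM p v ->
  gM p u v = gN (F p) (Defs.pushforward F p u) (Defs.pushforward F p v).
Proof.
have pD a b : Defs.pushforward F p (a + b) = Defs.pushforward F p a + Defs.pushforward F p b.
  rewrite !(pushforward_expansion _ (chart_at_dom (F p))) -big_split.
  apply: eq_bigr => i _ /=; rewrite -scalerDl dirderDv //.
  by apply: smooth_near_comp => //; apply: smooth_base_chart; exact: chart_at_dom.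
move=> hu hv.
have := submersion_isometry hF (horizontalD hu hv).
have := submersion_isometry hF hv; have := submersion_isometry hF hu.
rewrite (pD u v); move: (Defs.pushforward F p u) (Defs.pushforward F p v) => a b.
rewrite (metricDl hN) !(metricDr hN) (metricDl hM) !(metricDr hM).
rewrite (metricC hM p v u) (metricC hN (F p) b a) => -> -> E.
have half (x y z t : R) : x + t + (t + z) = x + y + (y + z) -> y = t by move=> ?; lra.
exact: half E.
Qed.

(** The metric on horizontal vectors does not change along the fibres. In base coordinates g(X, Y)
    is the sum of [k i j \o F] times X(b_i) Y(b_j). The field [V] kills [k i j \o F], and it kills
    b_i too, so that V(X(b_i)) = [V, X](b_i). *)
Lemma dirder_metric_horizontal p X Y V :
  smooth_vfield_near p X -> smooth_vfield_near p Y -> smooth_vfield_near p V ->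
  (\forall q \near p, horizontal F gM q (X q)) ->
  (\forall q \near p, horizontal F gM q (Y q)) ->
  (\forall q \near p, vertical F q (V q)) ->
  dirder (fun q => gM q (X q) (Y q) : R^o) p (V p) =
  gM p (bracket V X p) (Y p) + gM p (X p) (bracket V Y p).
Proof.
move=> sX sY sV hX hY vV; pose d := chart_at (F p).
pose e i : vfield N := chart_frame d (delta_mx 0 i).
have dp : cdom d (F p) := chart_at_dom _; have ad : atlas d := chart_at_atlas _.
pose k i j : N -> R^o := fun y => gN y (e i y) (e j y).
pose b := base_coord p.
have sk i j : smooth_near (F p) (k i j).
  by apply: smooth_near_metric => //; exact: smooth_vfield_frame.
have skF i j : smooth_near p (k i j \o F : M -> R^o) by exact: smooth_near_comp.
have sb i : smooth_near p (b i) by apply: smooth_near_comp => //; exact: smooth_base_chart.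
have G q u v : cdom d (F q) ->
    gN (F q) (Defs.pushforward F q u) (Defs.pushforward F q v) =
    \sum_i \sum_j k i j (F q) * (dirder (b i) q u * dirder (b j) q v).
  move=> dq; rewrite !(pushforward_expansion _ dq) metric_suml //.
  apply: eq_bigr => i _; rewrite metricZl // metric_sumr // mulr_sumr.
  by apply: eq_bigr => j _; rewrite metricZr // /k -/b; ring.
have pV q u : vertical F q u -> Defs.pushforward F q u = 0 by [].
(* One horizontal argument is enough, as a vertical part of [u] is orthogonal to [v] and kills every
   [b i]. This is needed because [u] will be a bracket, for which no horizontality is at hand. *)
have gG u v : horizontal F gM p v -> gM p u v =
    \sum_i \sum_j k i j (F p) * (dirder (b i) p u * dirder (b j) p v).
  move=> hv; rewrite -G // [in LHS](vproj_hproj p u) metricDl //.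
  rewrite (metricC hM p (vproj F gM p u)) hv ?add0r; last exact: vertical_vproj.
  rewrite (isometry_polar (@horizontal_hproj p u) hv); congr (gN _ _ _).
  rewrite !(pushforward_expansion _ dp); apply: eq_bigr => i _; congr (_ *: _).
  rewrite [in RHS](vproj_hproj p u) dirderDv; last exact: sb.
  rewrite [X in _ = X + _](vertical_dirder sF _ (vertical_vproj p u)) ?add0r //.
  exact: smooth_base_chart.
rewrite (@dirder_near _ _ _ p _ _ (fun q => \sum_i \sum_j
    (k i j \o F) q * (dirder (b i) q (X q) * dirder (b j) q (Y q)) : R^o)); last first.
  have := near_and (near_base_dom p) (near_and hX hY).
  by apply: filterS => q [dq [hXq hYq]]; rewrite (isometry_polar hXq hYq) G.
have sbX i : smooth_near p (fun q => dirder (b i) q (X q) : R^o) by exact: smooth_near_dirder.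
have sbY i : smooth_near p (fun q => dirder (b i) q (Y q) : R^o) by exact: smooth_near_dirder.
have sXY i j := smooth_nearM (sbX i) (sbY j).
have sT i j := smooth_nearM (skF i j) (sXY i j).
rewrite (dirder_sum _ (fun i => smooth_near_sum (sT i))).
have DB Z i : smooth_vfield_near p Z ->
    dirder (fun q => dirder (b i) q (Z q) : R^o) p (V p) = dirder (b i) p (bracket V Z p).
  move=> sZ; rewrite (dirder_bracket (sb i) sV sZ).
  have := dirder_comp_vertical0 sF (smooth_base_chart i dp) vV.
  by move=> /(dirder_near (Z p)) ->; rewrite dirder_cst subr0.
rewrite gG; last exact: nbhs_singleton hY.
rewrite (metricC hM) gG; last exact: nbhs_singleton hX.
rewrite [X in _ + X]exchange_big -big_split; apply: eq_bigr => i _ /=.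
rewrite (dirder_sum _ (sT i)) -big_split; apply: eq_bigr => j _ /=.
rewrite (dirderM _ (skF i j) (sXY i j)) (dirderM _ (sbX i) (sbY j)) !DB //.
rewrite (vertical_dirder sF (sk i j)); last exact: nbhs_singleton vV.
have -> : k j i (F p) = k i j (F p) by exact: (metricC hN).
have alg (a x dx y dy : R) :
  a * (x * dy + y * dx) + x * y * 0 = a * (dx * y) + a * (dy * x) by ring.
exact: alg.
Qed.

End Submersion.

Arguments horizontal_hproj {R m n M N F gM gN} hM hF p v.

(** * The Levi-Civita connection and its curvature *)

Section Connection.
Context {R : realType} {n : nat} {M : manifold R n}.
Context {g : bilinear_form M} {nabla : covariant_derivative M}.
Hypothesis hg : riemannian_metric g.
Hypothesis hn : levi_civita g nabla.
Implicit Types (p q : M) (f : M -> R^o) (u v w : 'rV[R]_n) (X Y Z : vfield M).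

Lemma nabla0l p Y : smooth_vfield_near p Y -> nabla (fun=> 0) Y p = 0.
Proof.
move=> sY; have := nabla_scalel hn (smooth_near_cst p 0) (smooth_vfield0 p) sY.
rewrite [RHS]scale0r => E; rewrite -[RHS]E; congr (nabla _ Y p).
by apply/funext => q; rewrite scaler0.
Qed.

Lemma nablaZr p (a : R) X Y : smooth_vfield_near p X -> smooth_vfield_near p Y ->
  nabla X (fun q => a *: Y q) p = a *: nabla X Y p.
Proof.
move=> sX sY; have := nabla_leibniz hn (smooth_near_cst p a) sX sY.
by rewrite dirder_cst scale0r add0r.
Qed.

Lemma nabla0r p X : smooth_vfield_near p X -> nabla X (fun=> 0) p = 0.
Proof.
move=> sX; have := nablaZr 0 sX (smooth_vfield0 p).
rewrite [RHS]scale0r => E; rewrite -[RHS]E; congr (nabla X _ p).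
by apply/funext => q; rewrite scaler0.
Qed.

Lemma nablaNr p X Y : smooth_vfield_near p X -> smooth_vfield_near p Y ->
  nabla X (fun q => - Y q) p = - nabla X Y p.
Proof.
move=> sX sY; rewrite -scaleN1r -(nablaZr _ sX sY); congr (nabla X _ p).
by apply/funext => q; rewrite scaleN1r.
Qed.

Lemma nablaBr p X Y Z : smooth_vfield_near p X -> smooth_vfield_near p Y ->
  smooth_vfield_near p Z ->
  nabla X (fun q => Y q - Z q) p = nabla X Y p - nabla X Z p.
Proof.
move=> sX sY sZ.
by rewrite (nabla_addr hn sX sY (smooth_vfieldN sZ)) (nablaNr sX sZ).
Qed.

(** The difference [D] of the two fields is zero near [p], so it equals [f *: D] with both [f] and
    [D] zero at [p], and the Leibniz rule returns zero. *)
Lemma nabla_near p X Y Y' : smooth_vfield_near p X -> smooth_vfield_near p Y ->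
  smooth_vfield_near p Y' -> {near p, Y =1 Y'} -> nabla X Y p = nabla X Y' p.
Proof.
move=> sX sY sY' YY'; apply/eqP; rewrite -subr_eq0 -(nablaBr sX sY sY').
pose D : vfield M := fun q => Y q - Y' q.
have sD : smooth_vfield_near p D := smooth_vfieldB sY sY'.
have D0 : \forall q \near p, D q = 0.
  by apply: filterS YY' => q YYq; rewrite /D YYq subrr.
have [f [sf f0 fD]] := vfield_absorb D0.
have := nabla_leibniz hn sf sX sD.
by rewrite -fD f0 (nbhs_singleton D0) scaler0 scale0r addr0 => ->.
Qed.

Lemma nabla_pt p X X' Y : smooth_vfield_near p X -> smooth_vfield_near p X' ->
  smooth_vfield_near p Y -> X p = X' p -> nabla X Y p = nabla X' Y p.
Proof.
move=> sX sX' sY; apply: (tensorial (L := fun X => nabla X Y p)) sX sX'.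
- by move=> X1 X2 s1 s2; exact: (nabla_addl hn s1 s2 sY).
- by move=> f X1 sf s1; exact: (nabla_scalel hn sf s1 sY).
Qed.

Lemma nablaNl p X Y : smooth_vfield_near p X -> smooth_vfield_near p Y ->
  nabla (fun q => - X q) Y p = - nabla X Y p.
Proof.
move=> sX sY; have E := nabla_scalel hn (smooth_near_cst p (-1)) sX sY.
rewrite [RHS]scaleN1r in E; rewrite -E; congr (nabla _ Y p).
by apply/funext => q; rewrite scaleN1r.
Qed.

Lemma nablaBl p X X' Y : smooth_vfield_near p X -> smooth_vfield_near p X' ->
  smooth_vfield_near p Y ->
  nabla (fun q => X q - X' q) Y p = nabla X Y p - nabla X' Y p.
Proof.
move=> sX sX' sY; rewrite (nabla_addl hn sX (smooth_vfieldN sX') sY).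
by rewrite (nablaNl sX' sY).
Qed.

Lemma smooth_nabla p X Y : smooth_vfield_near p X -> smooth_vfield_near p Y ->
  smooth_vfield_near p (nabla X Y).
Proof. exact: (nabla_smooth hn). Qed.

Lemma bracketC p X Y : bracket X Y p = - bracket Y X p.
Proof. by rewrite /bracket opprB. Qed.

(** Torsion freeness reduces the rules for the bracket to those for the connection. *)
Lemma bracketDl p X X' Y : smooth_vfield_near p X -> smooth_vfield_near p X' ->
  smooth_vfield_near p Y ->
  bracket (fun q => X q + X' q) Y p = bracket X Y p + bracket X' Y p.
Proof.
move=> sX sX' sY; have sXX := smooth_vfieldD sX sX'.
rewrite -(nabla_torsion_free hn sX sY) -(nabla_torsion_free hn sX' sY).
rewrite -(nabla_torsion_free hn sXX sY) (nabla_addl hn sX sX' sY).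
by rewrite (nabla_addr hn sY sX sX') opprD addrACA.
Qed.

Lemma bracketZl p f X Y : smooth_near p f -> smooth_vfield_near p X ->
  smooth_vfield_near p Y ->
  bracket (fun q => f q *: X q) Y p = f p *: bracket X Y p - dirder f p (Y p) *: X p.
Proof.
move=> sf sX sY; have sfX := smooth_vfieldZ sf sX.
rewrite -(nabla_torsion_free hn sX sY) -(nabla_torsion_free hn sfX sY).
rewrite (nabla_scalel hn sf sX sY) (nabla_leibniz hn sf sY sX).
by rewrite scalerBr opprD addrA addrAC.
Qed.

Lemma curvatureC p X Y Z : smooth_vfield_near p X -> smooth_vfield_near p Y ->
  smooth_vfield_near p Z -> curvature nabla X Y Z p = - curvature nabla Y X Z p.
Proof.
move=> sX sY sZ; have sXY := smooth_vfield_bracket sX sY.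
have sYX := smooth_vfield_bracket sY sX; have sNYX := smooth_vfieldN sYX.
have E : nabla (bracket X Y) Z p = - nabla (bracket Y X) Z p.
  rewrite -(nablaNl sYX sZ); apply: (nabla_pt sXY sNYX sZ); exact: bracketC.
have alg (a b c d : 'rV[R]_n) : c = - d -> a - b - c = - (b - a - d).
  by move=> ->; apply/rowP => i; rewrite !mxE; ring.
exact: (alg _ _ _ _ E).
Qed.

Lemma curvatureDl p X X' Y Z : smooth_vfield_near p X -> smooth_vfield_near p X' ->
  smooth_vfield_near p Y -> smooth_vfield_near p Z ->
  curvature nabla (fun q => X q + X' q) Y Z p =
  curvature nabla X Y Z p + curvature nabla X' Y Z p.
Proof.
move=> sX sX' sY sZ; have sXX := smooth_vfieldD sX sX'.
have sXZ := smooth_nabla sX sZ; have sXZ' := smooth_nabla sX' sZ.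
have sb := smooth_vfield_bracket sX sY; have sb' := smooth_vfield_bracket sX' sY.
have E1 := nabla_addl hn sX sX' (smooth_nabla sY sZ).
have E2 : nabla Y (nabla (fun q => X q + X' q) Z) p =
    nabla Y (nabla X Z) p + nabla Y (nabla X' Z) p.
  apply: etrans (nabla_addr hn sY sXZ sXZ').
  apply: nabla_near sY (smooth_nabla sXX sZ) (smooth_vfieldD sXZ sXZ') _.
  have := near_and (smooth_vfield_nbhs sX)
    (near_and (smooth_vfield_nbhs sX') (smooth_vfield_nbhs sZ)).
  by apply: filterS => q [s1 [s2 s3]]; exact: (nabla_addl hn s1 s2 s3).
have E3 := etrans (nabla_pt (smooth_vfield_bracket sXX sY) (smooth_vfieldD sb sb') sZ
  (bracketDl sX sX' sY)) (nabla_addl hn sb sb' sZ).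
have alg (t1 t2 t3 a a' b b' c c' : 'rV[R]_n) : t1 = a + a' -> t2 = b + b' ->
    t3 = c + c' -> t1 - t2 - t3 = a - b - c + (a' - b' - c').
  by move=> -> -> ->; apply/rowP => i; rewrite !mxE; ring.
exact: (alg _ _ _ _ _ _ _ _ _ E1 E2 E3).
Qed.

(** The derivative of [f] along [Y] comes once from the Leibniz rule and once from the bracket, and
    the two terms cancel. *)
Lemma curvatureZl p f X Y Z : smooth_near p f -> smooth_vfield_near p X ->
  smooth_vfield_near p Y -> smooth_vfield_near p Z ->
  curvature nabla (fun q => f q *: X q) Y Z p = f p *: curvature nabla X Y Z p.
Proof.
move=> sf sX sY sZ; have sfX := smooth_vfieldZ sf sX.
have sXZ := smooth_nabla sX sZ; have sb := smooth_vfield_bracket sX sY.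
have sYf := smooth_near_dirder sf sY.
have sfb := smooth_vfieldZ sf sb; have sfx := smooth_vfieldZ sYf sX.
have E1 := nabla_scalel hn sf sX (smooth_nabla sY sZ).
have E2 : nabla Y (nabla (fun q => f q *: X q) Z) p =
    dirder f p (Y p) *: nabla X Z p + f p *: nabla Y (nabla X Z) p.
  apply: etrans (nabla_leibniz hn sf sY sXZ).
  apply: nabla_near sY (smooth_nabla sfX sZ) (smooth_vfieldZ sf sXZ) _.
  have := near_and (smooth_vfield_nbhs sX)
    (near_and (smooth_near_nbhs sf) (smooth_vfield_nbhs sZ)).
  by apply: filterS => q [s1 [s2 s3]]; exact: (nabla_scalel hn s2 s1 s3).
have E3 := etrans (nabla_pt (smooth_vfield_bracket sfX sY) (smooth_vfieldB sfb sfx) sZ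
  (bracketZl sf sX sY)) (nablaBl sfb sfx sZ).
have alg (s t : R) (t1 t2 t3 a b c d d1 d2 : 'rV[R]_n) : t1 = s *: a ->
    t2 = t *: b + s *: c -> t3 = d1 - d2 -> d1 = s *: d -> d2 = t *: b ->
    t1 - t2 - t3 = s *: (a - c - d).
  by move=> -> -> -> -> ->; apply/rowP => i; rewrite !mxE; ring.
exact: (alg _ _ _ _ _ _ _ _ _ _ _ E1 E2 E3 (nabla_scalel hn sf sb sZ)
  (nabla_scalel hn sYf sX sZ)).
Qed.

Lemma curvatureDr p X Y Z Z' : smooth_vfield_near p X -> smooth_vfield_near p Y ->
  smooth_vfield_near p Z -> smooth_vfield_near p Z' ->
  curvature nabla X Y (fun q => Z q + Z' q) p =
  curvature nabla X Y Z p + curvature nabla X Y Z' p.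
Proof.
move=> sX sY sZ sZ'; have sZZ := smooth_vfieldD sZ sZ'.
have H A B : smooth_vfield_near p A -> smooth_vfield_near p B ->
    nabla A (nabla B (fun q => Z q + Z' q)) p =
    nabla A (nabla B Z) p + nabla A (nabla B Z') p.
  move=> sA sB; have s1 := smooth_nabla sB sZ; have s2 := smooth_nabla sB sZ'.
  apply: etrans (nabla_addr hn sA s1 s2).
  apply: nabla_near sA (smooth_nabla sB sZZ) (smooth_vfieldD s1 s2) _.
  have := near_and (smooth_vfield_nbhs sB)
    (near_and (smooth_vfield_nbhs sZ) (smooth_vfield_nbhs sZ')).
  by apply: filterS => q [h1 [h2 h3]]; exact: (nabla_addr hn h1 h2 h3).
have alg (t1 t2 t3 a a' b b' c c' : 'rV[R]_n) : t1 = a + a' -> t2 = b + b' ->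
    t3 = c + c' -> t1 - t2 - t3 = a - b - c + (a' - b' - c').
  by move=> -> -> ->; apply/rowP => i; rewrite !mxE; ring.
exact: (alg _ _ _ _ _ _ _ _ _ (H X Y sX sY) (H Y X sY sX)
  (nabla_addr hn (smooth_vfield_bracket sX sY) sZ sZ')).
Qed.

(** The second derivatives of [f] cancel against its derivative along the bracket, and the
    first-order terms cancel in pairs. *)
Lemma curvatureZr p f X Y Z : smooth_near p f -> smooth_vfield_near p X ->
  smooth_vfield_near p Y -> smooth_vfield_near p Z ->
  curvature nabla X Y (fun q => f q *: Z q) p = f p *: curvature nabla X Y Z p.
Proof.
move=> sf sX sY sZ; have sfZ := smooth_vfieldZ sf sZ.
have H A B : smooth_vfield_near p A -> smooth_vfield_near p B ->
    nabla A (nabla B (fun q => f q *: Z q)) p =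
    dirder (fun q => dirder f q (B q) : R^o) p (A p) *: Z p +
    dirder f p (B p) *: nabla A Z p + (dirder f p (A p) *: nabla B Z p +
    f p *: nabla A (nabla B Z) p).
  move=> sA sB; have sBZ := smooth_nabla sB sZ; have sBf := smooth_near_dirder sf sB.
  have s1 := smooth_vfieldZ sBf sZ; have s2 := smooth_vfieldZ sf sBZ.
  rewrite -(nabla_leibniz hn sBf sA sZ) -(nabla_leibniz hn sf sA sBZ).
  apply: etrans (nabla_addr hn sA s1 s2).
  apply: nabla_near sA (smooth_nabla sB sfZ) (smooth_vfieldD s1 s2) _.
  have := near_and (smooth_vfield_nbhs sB)
    (near_and (smooth_near_nbhs sf) (smooth_vfield_nbhs sZ)).
  by apply: filterS => q [h1 [h2 h3]]; exact: (nabla_leibniz hn h2 h1 h3).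
have alg (xy yx br x y t : R) (t1 t2 t3 z a b ab ba c : 'rV[R]_n) : br = xy - yx ->
    t1 = xy *: z + y *: a + (x *: b + t *: ab) ->
    t2 = yx *: z + x *: b + (y *: a + t *: ba) ->
    t3 = br *: z + t *: c -> t1 - t2 - t3 = t *: (ab - ba - c).
  by move=> -> -> -> ->; apply/rowP => i; rewrite !mxE; ring.
exact: (alg _ _ _ _ _ _ _ _ _ _ _ _ _ _ _ (dirder_bracket sf sX sY) (H X Y sX sY)
  (H Y X sY sX) (nabla_leibniz hn sf (smooth_vfield_bracket sX sY) sZ)).
Qed.

Lemma curvature_pt p X X' Y Y' Z Z' :
  smooth_vfield_near p X -> smooth_vfield_near p X' ->
  smooth_vfield_near p Y -> smooth_vfield_near p Y' ->
  smooth_vfield_near p Z -> smooth_vfield_near p Z' ->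
  X p = X' p -> Y p = Y' p -> Z p = Z' p ->
  curvature nabla X Y Z p = curvature nabla X' Y' Z' p.
Proof.
move=> sX sX' sY sY' sZ sZ' XX YY ZZ.
have L A A' B C : smooth_vfield_near p A -> smooth_vfield_near p A' ->
    smooth_vfield_near p B -> smooth_vfield_near p C -> A p = A' p ->
    curvature nabla A B C p = curvature nabla A' B C p.
  move=> sA sA' sB sC; apply: (tensorial (L := fun X => curvature nabla X B C p)) sA sA'.
    by move=> X1 X2 s1 s2; exact: (curvatureDl s1 s2 sB sC).
  by move=> f X1 sf s1; exact: (curvatureZl sf s1 sB sC).
rewrite (L _ _ _ _ sX sX' sY sZ XX).
rewrite (curvatureC sX' sY sZ) (L _ _ _ _ sY sY' sX' sZ YY) -(curvatureC sX' sY' sZ).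
apply: (tensorial (L := fun Z => curvature nabla X' Y' Z p)) sZ sZ' ZZ.
  by move=> X1 X2 s1 s2; exact: (curvatureDr sX' sY' s1 s2).
by move=> f X1 sf s1; exact: (curvatureZr sf sX' sY' s1).
Qed.

Lemma nabla_perp p X Y Z : smooth_vfield_near p X -> smooth_vfield_near p Y ->
  smooth_vfield_near p Z -> (\forall q \near p, g q (Y q) (Z q) = 0) ->
  g p (nabla X Y p) (Z p) = - g p (Y p) (nabla X Z p).
Proof.
move=> sX sY sZ YZ; apply/eqP; rewrite -addr_eq0 -(nabla_metric hn sX sY sZ).
by rewrite (dirder_near _ YZ) dirder_cst.
Qed.

Lemma vfield_through p w : exists2 X, smooth_vfield_near p X & X p = w.
Proof.
exists (fun q => \sum_j w 0 j *: chart_frame (chart_at p) (delta_mx 0 j) q).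
  exact: (smooth_vfield_sum (fun j => smooth_vfieldZ (smooth_near_cst p (w 0 j))
    (smooth_vfield_frame _ (chart_at_atlas p) (chart_at_dom p)))).
rewrite [RHS](frame_expansion _ (chart_at_atlas p) (chart_at_dom p)).
by apply: eq_bigr => j _; rewrite dirder_chart_at.
Qed.

End Connection.

(** * Cosymplectic manifolds *)

Section Cosymplectic.
Context {R : realType} {n : nat} {M : manifold R n}.
Context {phi : endo_field M} {xi : vfield M} {eta : covector_field M}.
Context {g : bilinear_form M} {nabla : covariant_derivative M}.
Hypothesis hc : cosymplectic phi xi eta g.
Hypothesis hn : levi_civita g nabla.
Implicit Types (p q : M) (f : M -> R^o) (u v w : 'rV[R]_n) (X Y Z W : vfield M).

Let acm : almost_contact_metric phi xi eta g := cosymplectic_acm hc.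
Let hg : riemannian_metric g := acm_metric acm.
Let hphi : tensor11 phi := acm_phi acm.
Let sxi p : smooth_vfield_near p xi := acm_xi acm p.

Lemma phiD p u v : phi p (u + v) = phi p u + phi p v.
Proof. by rewrite -[u in LHS]scale1r (tensor11_linear hphi) scale1r. Qed.

Lemma phi0 p : phi p 0 = 0.
Proof. by apply: (addrI (phi p 0)); rewrite -phiD !addr0. Qed.

Lemma phiZ p (a : R) u : phi p (a *: u) = a *: phi p u.
Proof. by rewrite -[a *: u]addr0 (tensor11_linear hphi) phi0 addr0. Qed.

Lemma phiN p u : phi p (- u) = - phi p u.
Proof. by rewrite -scaleN1r phiZ scaleN1r. Qed.

Lemma phiB p u v : phi p (u - v) = phi p u - phi p v.
Proof. by rewrite phiD phiN. Qed.

Lemma smooth_phi p X : smooth_vfield_near p X -> smooth_vfield_near p (app phi X).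
Proof. exact: (tensor11_smooth hphi). Qed.

Lemma phi_skew p u v : g p (phi p u) v = - g p u (phi p v).
Proof.
have := acm_compatible acm p u (phi p v).
rewrite (acm_phi2 acm) (acm_eta_phi acm) mulr0 subr0 => <-.
rewrite (metricDr hg) (metricNr hg) (metricZr hg).
rewrite -(acm_eta_dual acm) (acm_eta_phi acm) mulr0 addr0 opprK.
by [].
Qed.

Lemma metric_xi p : g p (xi p) (xi p) = 1.
Proof. by rewrite -(acm_eta_dual acm) (acm_eta_xi acm). Qed.

(* With the fundamental form Phi(Y, Z) = g(Y, phi Z): [dphi X Y] is (nabla_X phi) Y,
   [nabla_Phi X Y Z] is (nabla_X Phi)(Y, Z), and [nabla_eta X w] below is (nabla_X eta)(w). *)
Definition dphi X Y : vfield M := fun p => nabla X (app phi Y) p - phi p (nabla X Y p).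

Definition nabla_Phi X Y Z p : R := g p (Y p) (dphi X Z p).

Lemma nabla_PhiE p X Y Z :
  nabla_Phi X Y Z p = g p (Y p) (nabla X (app phi Z) p) + g p (phi p (Y p)) (nabla X Z p).
Proof. by rewrite /nabla_Phi /dphi (metricBr hg) phi_skew. Qed.

(** Comes from differentiating g(Y, phi Z) + g(phi Y, Z) = 0 along [X]. *)
Lemma nabla_Phi_skew p X Y Z : smooth_vfield_near p X -> smooth_vfield_near p Y ->
  smooth_vfield_near p Z -> nabla_Phi X Y Z p = - nabla_Phi X Z Y p.
Proof.
move=> sX sY sZ; have spY := smooth_phi sY; have spZ := smooth_phi sZ.
have E1 := nabla_metric hn sX sY spZ; have E2 := nabla_metric hn sX spY sZ.
have s1 := smooth_near_metric hg sY spZ; have s2 := smooth_near_metric hg spY sZ.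
have := dirderD (X p) s1 s2; rewrite E1 E2.
rewrite (_ : (fun q => _ + _) = fun=> 0); last first.
  by apply/funext => q; rewrite /app phi_skew addrN.
rewrite dirder_cst !nabla_PhiE.
rewrite (metricC hg p (Z p)) (metricC hg p (phi p (Z p))).
move: (g p (nabla X Y p) (app phi Z p)) (g p (Y p) _) (g p _ (Z p)) (g p _ _) => a b c d.
rewrite /app => E; apply/eqP; rewrite -addr_eq0; apply/eqP; move: E.
lra.
Qed.

(** For the Levi-Civita connection the exterior derivative of Phi is the cyclic sum of nabla Phi. *)
Lemma nabla_Phi_cyclic p X Y Z : smooth_vfield_near p X -> smooth_vfield_near p Y ->
  smooth_vfield_near p Z -> nabla_Phi X Y Z p + nabla_Phi Y Z X p + nabla_Phi Z X Y p = 0.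
Proof.
move=> sX sY sZ; have := cosymplectic_Phi_closed hc sX sY sZ.
have spX := smooth_phi sX; have spY := smooth_phi sY; have spZ := smooth_phi sZ.
have E1 := nabla_metric hn sX sY spZ; have E2 := nabla_metric hn sY sZ spX.
have E3 := nabla_metric hn sZ sX spY.
have Br (A C : vfield M) w : smooth_vfield_near p A -> smooth_vfield_near p C ->
    g p (bracket A C p) w = g p (nabla A C p) w - g p (nabla C A p) w.
  by move=> sA sB; rewrite -(metricBl hg) (nabla_torsion_free hn sA sB).
have alg (d1 d2 d3 b1 b2 b3 a1 a2 a3 c1 c2 c3 e1 e2 e3 s1 s2 s3 : R) :
    d1 = a1 + c1 -> d2 = a2 + c2 -> d3 = a3 + c3 ->
    b1 = a1 - e1 -> b2 = a2 - e2 -> b3 = a3 - e3 ->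
    s1 = c1 + e3 -> s2 = c2 + e1 -> s3 = c3 + e2 ->
    d1 + d2 + d3 - b1 - b2 - b3 = 0 -> s1 + s2 + s3 = 0.
  by move=> -> -> -> -> -> -> -> -> -> <-; ring.
have SE (A nabla_eta C : vfield M) : nabla_Phi A nabla_eta C p =
    g p (nabla_eta p) (nabla A (app phi C) p) + g p (nabla A C p) (phi p (nabla_eta p)).
  by rewrite nabla_PhiE [X in _ + X](metricC hg).
exact: (alg _ _ _ _ _ _ _ _ _ _ _ _ _ _ _ _ _ _ E1 E2 E3 (Br _ _ _ sX sY) (Br _ _ _ sY sZ)
  (Br _ _ _ sZ sX) (SE X Y Z) (SE Y Z X) (SE Z X Y)).
Qed.

(** As [eta] is closed, normality says that the Nijenhuis torsion of [phi] is zero. Torsion freeness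
    turns its brackets into covariant derivatives of [phi], and the result is paired with [W]. *)
Lemma nabla_Phi_normal p W Y Z : smooth_vfield_near p W -> smooth_vfield_near p Y ->
  smooth_vfield_near p Z ->
  nabla_Phi (app phi Y) W Z p - nabla_Phi (app phi Z) W Y p + nabla_Phi Y (app phi W) Z p - nabla_Phi Z (app phi W) Y p = 0.
Proof.
move=> sW sY sZ; have spY := smooth_phi sY; have spZ := smooth_phi sZ.
have := cosymplectic_normal hc sY sZ.
rewrite (cosymplectic_eta_closed hc sY sZ) scale0r addr0 /nijenhuis => N0.
have := metric0r hg p (W p); rewrite -N0.
have B1 := nabla_torsion_free hn spY spZ.
have B2 := nabla_torsion_free hn spY sZ.
have B3 := nabla_torsion_free hn sY spZ.
have B4 := nabla_torsion_free hn sY sZ.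
have NE : phi p (phi p (bracket Y Z p)) + bracket (app phi Y) (app phi Z) p -
    phi p (bracket (app phi Y) Z p) - phi p (bracket Y (app phi Z) p) =
    dphi (app phi Y) Z p - dphi (app phi Z) Y p - phi p (dphi Y Z p) + phi p (dphi Z Y p).
  rewrite /dphi.
  have alg (b1 b2 b3 b4 c1 c2 c3 c4 d1 d2 d3 d4 : 'rV[R]_n) :
      c1 - d1 = b1 -> c2 - d2 = b2 -> c3 - d3 = b3 -> c4 - d4 = b4 ->
      phi p (phi p b4) + b1 - phi p b2 - phi p b3 =
      c1 - phi p c2 - (d1 - phi p d3) - phi p (c3 - phi p c4) + phi p (d2 - phi p d4).
    move=> <- <- <- <-; rewrite !phiB.
    by apply/rowP => i; rewrite !mxE; ring.
  exact: (alg _ _ _ _ _ _ _ _ _ _ _ _ B1 B2 B3 B4).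
rewrite NE; have G (a b c d : 'rV[R]_n) : g p (W p) (a - b - phi p c + phi p d) =
    g p (W p) a - g p (W p) b + g p (phi p (W p)) c - g p (phi p (W p)) d.
  by rewrite !(metricDr hg, metricNr hg) !phi_skew opprK.
by rewrite G.
Qed.

Definition nabla_eta X w p : R := g p (nabla X xi p) w.

Lemma app_phi_phi X : app phi (app phi X) = fun q => eta q (X q) *: xi q - X q.
Proof. by apply/funext => q; rewrite /app (acm_phi2 acm) addrC. Qed.

Lemma app_phi_xi : app phi xi = fun=> 0.
Proof. by apply/funext => q; rewrite /app (acm_phi_xi acm). Qed.

Lemma smooth_eta p X : smooth_vfield_near p X -> smooth_near p (fun q => eta q (X q) : R^o).
Proof. exact: (one_form_smooth (acm_eta acm)). Qed.

(** For the Levi-Civita connection the exterior derivative of [eta] is the skew part of nabla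
    eta. *)
Lemma nabla_eta_sym p X Y : smooth_vfield_near p X -> smooth_vfield_near p Y ->
  nabla_eta X (Y p) p = nabla_eta Y (X p) p.
Proof.
move=> sX sY; have := cosymplectic_eta_closed hc sX sY; rewrite /d1.
have ed Z : (fun q => eta q (Z q) : R^o) = fun q => g q (Z q) (xi q).
  by apply/funext => q; rewrite (acm_eta_dual acm).
rewrite !ed (nabla_metric hn sX sY (sxi p)) (nabla_metric hn sY sX (sxi p)).
rewrite (acm_eta_dual acm) -(nabla_torsion_free hn sX sY) (metricBl hg).
rewrite /nabla_eta (metricC hg p (nabla X xi p)) (metricC hg p (nabla Y xi p)).
have alg (a b c d : R) : a + b - (c + d) - (a - c) = 0 -> b = d by move=> E; lra.
exact: alg.
Qed.

Lemma nabla_eta_xi p X : smooth_vfield_near p X -> nabla_eta X (xi p) p = 0.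
Proof.
move=> sX; have := nabla_metric hn sX (sxi p) (sxi p).
rewrite (_ : (fun q => _) = fun=> 1); last by apply/funext => q; exact: metric_xi.
rewrite dirder_cst /nabla_eta (metricC hg p (xi p)).
have alg (a : R) : 0 = a + a -> a = 0 by move=> E; lra.
exact: alg.
Qed.

Lemma nabla_Phi_xi p X W : smooth_vfield_near p X -> nabla_Phi X W xi p = nabla_eta X (phi p (W p)) p.
Proof.
move=> sX; rewrite nabla_PhiE app_phi_xi (nabla0r hn sX) (metric0r hg) add0r.
by rewrite /nabla_eta (metricC hg).
Qed.

Lemma nabla_eta_phiphi p Y W : smooth_vfield_near p Y -> nabla_eta Y (phi p (phi p (W p))) p = - nabla_eta Y (W p) p.
Proof.
move=> sY; rewrite (acm_phi2 acm) /nabla_eta (metricDr hg) (metricNr hg) (metricZr hg).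
by rewrite [X in _ + _ * X](nabla_eta_xi sY) mulr0 addr0.
Qed.

(** Let A = (nabla_{phi Y} eta)(phi W), B = (nabla_Y eta)(W) and C = (nabla_xi Phi)(phi W, Y).
    Normality for [Y] and [xi] says A - B - C = 0, and the closedness of Phi on [xi], phi W, [Y]
    says A + B + C = 0. *)
Lemma nabla_eta_phi p Y W : smooth_vfield_near p Y -> smooth_vfield_near p W ->
  nabla_eta (app phi Y) (phi p (W p)) p = 0.
Proof.
move=> sY sW; have spY := smooth_phi sY; have spW := smooth_phi sW.
have := nabla_Phi_normal sW sY (sxi p); rewrite app_phi_xi.
have -> : nabla_Phi (fun=> 0) W Y p = 0.
  by rewrite nabla_PhiE (nabla0l hn spY) (nabla0l hn sY) !(metric0r hg) addr0.
rewrite (nabla_Phi_xi W spY) (nabla_Phi_xi (app phi W) sY) [nabla_eta Y _ p](nabla_eta_phiphi W sY).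
have := nabla_Phi_cyclic (sxi p) spW sY.
rewrite (nabla_Phi_xi Y spW) (nabla_Phi_skew sY (sxi p) spW) (nabla_Phi_xi (app phi W) sY) [nabla_eta Y _ p](nabla_eta_phiphi W sY).
have : nabla_eta (app phi W) (phi p (Y p)) p = nabla_eta (app phi Y) (phi p (W p)) p := nabla_eta_sym spW spY.
move=> ->; move: (nabla_eta _ _ p) (nabla_eta _ _ p) (nabla_Phi _ _ _ p) => a b c.
lra.
Qed.

(** In [nabla_eta_phi] for phi X and phi Z both arguments of nabla eta carry phi squared. By
    [nabla_eta_phiphi] it amounts to a sign in the second argument, and the symmetry of nabla eta
    carries this over to the first. *)
Lemma nabla_xi p X : smooth_vfield_near p X -> nabla X xi p = 0.
Proof.
move=> sX; apply: (metric_inj hg (p := p)) => w; rewrite (metric0l hg).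
have [Z sZ <-] := vfield_through p w.
have spX := smooth_phi sX; have spZ := smooth_phi sZ.
have := nabla_eta_phi spX spZ; rewrite [LHS](nabla_eta_phiphi Z (smooth_phi spX)).
rewrite (nabla_eta_sym (smooth_phi spX) sZ) [nabla_eta Z _ p](nabla_eta_phiphi X sZ) opprK.
by rewrite (nabla_eta_sym sZ sX).
Qed.

Lemma eta_nabla p X Y : smooth_vfield_near p X -> smooth_vfield_near p Y ->
  eta p (nabla X Y p) = dirder (fun q => eta q (Y q) : R^o) p (X p).
Proof.
move=> sX sY.
rewrite (_ : (fun q => _) = fun q => g q (Y q) (xi q)); last first.
  by apply/funext => q; rewrite (acm_eta_dual acm).
rewrite (nabla_metric hn sX sY (sxi p)) (nabla_xi sX) (metric0r hg) addr0.
exact: (acm_eta_dual acm).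
Qed.

Lemma nabla_phiphi p X Y : smooth_vfield_near p X -> smooth_vfield_near p Y ->
  nabla X (app phi (app phi Y)) p = phi p (phi p (nabla X Y p)).
Proof.
move=> sX sY; rewrite app_phi_phi.
have se := smooth_eta sY; have sZ := smooth_vfieldZ se (sxi p).
rewrite (nablaBr hn sX sZ sY) (nabla_leibniz hn se sX (sxi p)) (nabla_xi sX) scaler0 addr0.
by rewrite (acm_phi2 acm) (eta_nabla sX sY) addrC.
Qed.

(** Since phi squared is parallel, [phi] anticommutes with its covariant derivative. *)
Lemma nabla_Phi_phi p X W Y : smooth_vfield_near p X -> smooth_vfield_near p Y ->
  nabla_Phi X W (app phi Y) p = nabla_Phi X (app phi W) Y p.
Proof.
move=> sX sY; rewrite !nabla_PhiE (nabla_phiphi sX sY).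
rewrite /app (phi_skew p (phi p (W p))) addrC; congr (_ + _).
by rewrite phi_skew opprK.
Qed.

(** Skewness and [nabla_Phi_phi] leave four other unknown values of nabla Phi. The closedness of Phi
    on (phi Y, W, Z), minus that on (phi Z, W, Y), minus the normality relation eliminates them and
    leaves twice the wanted value. *)
Lemma nabla_Phi_phi0 p W Z Y : smooth_vfield_near p W -> smooth_vfield_near p Z ->
  smooth_vfield_near p Y -> nabla_Phi W Z (app phi Y) p = 0.
Proof.
move=> sW sZ sY.
have spW := smooth_phi sW; have spZ := smooth_phi sZ; have spY := smooth_phi sY.
have c1 := nabla_Phi_cyclic spY sW sZ; have c2 := nabla_Phi_cyclic spZ sW sY.
have nn := nabla_Phi_normal sW sY sZ.
have e1 : nabla_Phi Y (app phi Z) W p = - nabla_Phi Y (app phi W) Z p.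
  by rewrite -(nabla_Phi_phi _ sY sW) (nabla_Phi_skew sY sZ spW).
have e2 : nabla_Phi Z (app phi Y) W p = - nabla_Phi Z (app phi W) Y p.
  by rewrite -(nabla_Phi_phi _ sZ sW) (nabla_Phi_skew sZ sY spW).
have e3 : nabla_Phi W Y (app phi Z) p = - nabla_Phi W Z (app phi Y) p.
  by rewrite (nabla_Phi_phi _ sW sZ) (nabla_Phi_skew sW spY sZ).
move: c1 c2 nn; rewrite e1 e2 e3.
move: (nabla_Phi (app phi Y) W Z p) (nabla_Phi (app phi Z) W Y p) (nabla_Phi Y (app phi W) Z p)
  (nabla_Phi Z (app phi W) Y p) (nabla_Phi W Z (app phi Y) p) => a b c d e.
lra.
Qed.

(** [nabla_Phi_phi0] amounts to the commutation for fields in the image of [phi]. It is used for phi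
    (phi Y): there [nabla_phiphi] takes phi squared out on both sides, and on vectors killed by
    [eta] phi squared is only a sign. *)
Lemma nabla_phi p X Y : smooth_vfield_near p X -> smooth_vfield_near p Y ->
  nabla X (app phi Y) p = phi p (nabla X Y p).
Proof.
move=> sX sY; have spY := smooth_phi sY.
have E Z : smooth_vfield_near p Z ->
    nabla X (app phi (app phi Z)) p = phi p (nabla X (app phi Z) p).
  move=> sZ; apply: (metric_inj hg (p := p)) => w.
  have [W sW <-] := vfield_through p w.
  have := nabla_Phi_phi0 sX sW sZ; rewrite /nabla_Phi /dphi (metricBr hg) => /eqP; rewrite subr_eq0.
  by rewrite !(metricC hg p (W p)) => /eqP.
have := E _ spY; rewrite (nabla_phiphi sX spY).
have -> : nabla X (app phi (app phi Y)) p = phi p (phi p (nabla X Y p)) by exact: nabla_phiphi.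
have e0 : eta p (nabla X (app phi Y) p) = 0.
  rewrite (eta_nabla sX spY) (_ : (fun q => _) = fun=> 0) ?dirder_cst //.
  by apply/funext => q; exact: (acm_eta_phi acm).
have pp u : eta p u = 0 -> phi p (phi p u) = - u.
  by move=> u0; rewrite (acm_phi2 acm) u0 scale0r addr0.
by rewrite (pp _ e0) (pp _ (acm_eta_phi acm _ _)) => /oppr_inj.
Qed.

End Cosymplectic.

(** * O'Neill's tensor T *)

Section ONeill.
Context {R : realType} {m n : nat} {M : manifold R m} {N : manifold R n}.
Context {F : M -> N} {g : bilinear_form M} {gN : bilinear_form N}.
Context {nabla : covariant_derivative M}.
Hypotheses (hg : riemannian_metric g) (hN : riemannian_metric gN).
Hypothesis hn : levi_civita g nabla.
Hypothesis hF : riemannian_submersion F g gN.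
Implicit Types (p q : M) (f : M -> R^o) (u v w : 'rV[R]_m) (X Y Z V A B : vfield M).

Local Notation P := (vproj F g).
Local Notation Q := (hproj F g).
Local Notation T := (oneillT F g nabla).
Local Notation near_vertical p V := (\forall q \near p, vertical F q (V q)).
Local Notation near_horizontal p X := (\forall q \near p, horizontal F g q (X q)).

Let sF : smooth_map F := submersion_smooth hF.
Let sP p X : smooth_vfield_near p X -> smooth_vfield_near p (app P X) :=
  smooth_vproj hg hF (X := X).
Let sQ p X : smooth_vfield_near p X -> smooth_vfield_near p (app Q X) :=
  smooth_hproj hg hF (X := X).

Lemma vprojD p u v : P p (u + v) = P p u + P p v.
Proof. by rewrite -[u in LHS]scale1r (vprojZD hg hF) scale1r. Qed.

Lemma vproj0 p : P p 0 = 0.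
Proof. exact: (vproj_vertical hg hF (vertical0 sF p)). Qed.

Lemma vprojZ p (a : R) u : P p (a *: u) = a *: P p u.
Proof. by rewrite -[a *: u]addr0 (vprojZD hg hF) vproj0 addr0. Qed.

Lemma hproj0 p : Q p 0 = 0.
Proof. exact: (hproj_vertical hg hF (vertical0 sF p)). Qed.

Lemma hprojD p u v : Q p (u + v) = Q p u + Q p v.
Proof. by rewrite -[u in LHS]scale1r (hprojZD hg hF) scale1r. Qed.

Lemma hprojZ p (a : R) u : Q p (a *: u) = a *: Q p u.
Proof. by rewrite -[a *: u]addr0 (hprojZD hg hF) hproj0 addr0. Qed.

Lemma near_vertical_vproj p V : near_vertical p (app P V).
Proof. by near=> q; exact: (vertical_vproj hg hF). Unshelve. all: by end_near. Qed.

Lemma near_horizontal_hproj p V : near_horizontal p (app Q V).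
Proof. by near=> q; exact: (horizontal_hproj hg hF). Unshelve. all: by end_near. Qed.

Lemma smooth_oneillT p A B : smooth_vfield_near p A -> smooth_vfield_near p B ->
  smooth_vfield_near p (T A B).
Proof.
move=> sA sB; apply: smooth_vfieldD.
  exact: (sQ (smooth_nabla hn (sP sA) (sP sB))).
exact: (sP (smooth_nabla hn (sP sA) (sQ sB))).
Qed.

(** [B] is differentiated, so it is taken vertical near [p]; of [A] only the value at [p] enters. *)
Lemma oneillT_vertical p A B : smooth_vfield_near p A -> smooth_vfield_near p B ->
  vertical F p (A p) -> near_vertical p B -> T A B p = Q p (nabla A B p).
Proof.
move=> sA sB vA vB; rewrite /oneillT.
have PA : app P A p = A p by exact: (vproj_vertical hg hF vA).
have PB : {near p, app P B =1 B}.
  by apply: filterS vB => q vBq; exact: (vproj_vertical hg hF vBq).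
have QB : {near p, app Q B =1 fun=> 0}.
  by apply: filterS vB => q vBq; exact: (hproj_vertical hg hF vBq).
have E1 := nabla_near hn (sP sA) (sP sB) sB PB.
have E2 := nabla_near hn (sP sA) (sQ sB) (smooth_vfield0 p) QB.
rewrite E1 E2 (nabla0r hn (sP sA)) vproj0 addr0.
by rewrite (nabla_pt hn (sP sA) sA sB PA).
Qed.

Lemma oneillT_horizontal p A B : smooth_vfield_near p A -> smooth_vfield_near p B ->
  vertical F p (A p) -> near_horizontal p B -> T A B p = P p (nabla A B p).
Proof.
move=> sA sB vA hB; rewrite /oneillT.
have PA : app P A p = A p by exact: (vproj_vertical hg hF vA).
have PB : {near p, app P B =1 fun=> 0}.
  by apply: filterS hB => q hBq; exact: (vproj_horizontal hg hF hBq).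
have QB : {near p, app Q B =1 B}.
  by apply: filterS hB => q hBq; exact: (hproj_horizontal hg hF hBq).
have E1 := nabla_near hn (sP sA) (sP sB) (smooth_vfield0 p) PB.
have E2 := nabla_near hn (sP sA) (sQ sB) sB QB.
rewrite E1 E2 (nabla0r hn (sP sA)) hproj0 add0r.
by rewrite (nabla_pt hn (sP sA) sA sB PA).
Qed.

Lemma oneillT_ptl p A A' B : smooth_vfield_near p A -> smooth_vfield_near p A' ->
  smooth_vfield_near p B -> A p = A' p -> T A B p = T A' B p.
Proof.
move=> sA sA' sB AA; have PA : app P A p = app P A' p by rewrite /app AA.
rewrite /oneillT (nabla_pt hn (sP sA) (sP sA') (sP sB) PA).
by rewrite (nabla_pt hn (sP sA) (sP sA') (sQ sB) PA).
Qed.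

Lemma app_vprojD A B : app P (fun q => A q + B q) = fun q => app P A q + app P B q.
Proof. by apply/funext => q; exact: vprojD. Qed.

Lemma app_hprojD A B : app Q (fun q => A q + B q) = fun q => app Q A q + app Q B q.
Proof. by apply/funext => q; exact: hprojD. Qed.

Lemma app_vprojZ f A : app P (fun q => f q *: A q) = fun q => f q *: app P A q.
Proof. by apply/funext => q; exact: vprojZ. Qed.

Lemma app_hprojZ f A : app Q (fun q => f q *: A q) = fun q => f q *: app Q A q.
Proof. by apply/funext => q; exact: hprojZ. Qed.

Lemma oneillTDl p A A' B : smooth_vfield_near p A -> smooth_vfield_near p A' ->
  smooth_vfield_near p B -> T (fun q => A q + A' q) B p = T A B p + T A' B p.
Proof.
move=> sA sA' sB; rewrite /oneillT app_vprojD.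
rewrite (nabla_addl hn (sP sA) (sP sA') (sP sB)) (nabla_addl hn (sP sA) (sP sA') (sQ sB)).
by rewrite hprojD vprojD addrACA.
Qed.

Lemma oneillTZl p f A B : smooth_near p f -> smooth_vfield_near p A ->
  smooth_vfield_near p B -> T (fun q => f q *: A q) B p = f p *: T A B p.
Proof.
move=> sf sA sB; rewrite /oneillT app_vprojZ.
rewrite (nabla_scalel hn sf (sP sA) (sP sB)) (nabla_scalel hn sf (sP sA) (sQ sB)).
by rewrite hprojZ vprojZ -scalerDr.
Qed.

Lemma oneillTDr p A B B' : smooth_vfield_near p A -> smooth_vfield_near p B ->
  smooth_vfield_near p B' -> T A (fun q => B q + B' q) p = T A B p + T A B' p.
Proof.
move=> sA sB sB'; rewrite /oneillT app_vprojD app_hprojD.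
rewrite (nabla_addr hn (sP sA) (sP sB) (sP sB')) (nabla_addr hn (sP sA) (sQ sB) (sQ sB')).
by rewrite hprojD vprojD addrACA.
Qed.

(** The derivative of [f] multiplies the horizontal part of a vertical vector and the vertical part
    of a horizontal one, which are both zero. *)
Lemma oneillTZr p f A B : smooth_near p f -> smooth_vfield_near p A ->
  smooth_vfield_near p B -> T A (fun q => f q *: B q) p = f p *: T A B p.
Proof.
move=> sf sA sB; rewrite /oneillT app_vprojZ app_hprojZ.
rewrite (nabla_leibniz hn sf (sP sA) (sP sB)) (nabla_leibniz hn sf (sP sA) (sQ sB)).
rewrite hprojD vprojD !hprojZ !vprojZ.
rewrite [app P B p](_ : _ = P p (B p)) // [app Q B p](_ : _ = Q p (B p)) //.
rewrite (hproj_vertical hg hF (vertical_vproj hg hF p (B p))).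
rewrite (vproj_horizontal hg hF (horizontal_hproj hg hF p (B p))).
by rewrite !scaler0 !add0r -scalerDr.
Qed.

Lemma oneillT_ptr p A B B' : smooth_vfield_near p A -> smooth_vfield_near p B ->
  smooth_vfield_near p B' -> B p = B' p -> T A B p = T A B' p.
Proof.
move=> sA sB sB'; apply: (tensorial (L := fun B => T A B p)) sB sB'.
- by move=> B1 B2 s1 s2; exact: (oneillTDr sA s1 s2).
- by move=> f B1 sf s1; exact: (oneillTZr sf sA s1).
Qed.

Lemma nabla_oneillT_ptE p E E' A B : smooth_vfield_near p E -> smooth_vfield_near p E' ->
  smooth_vfield_near p A -> smooth_vfield_near p B -> E p = E' p ->
  nabla_oneillT F g nabla E A B p = nabla_oneillT F g nabla E' A B p.
Proof.
move=> sE sE' sA sB EE; rewrite /nabla_oneillT.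
have sEA := smooth_nabla hn sE sA; have sEA' := smooth_nabla hn sE' sA.
have sEB := smooth_nabla hn sE sB; have sEB' := smooth_nabla hn sE' sB.
rewrite (nabla_pt hn sE sE' (smooth_oneillT sA sB) EE).
rewrite (oneillT_ptl sEA sEA' sB (nabla_pt hn sE sE' sA EE)).
by rewrite (oneillT_ptr sA sEB sEB' (nabla_pt hn sE sE' sB EE)).
Qed.

Lemma nabla_oneillTZ p (a : R) E A B : smooth_vfield_near p E ->
  smooth_vfield_near p A -> smooth_vfield_near p B ->
  nabla_oneillT F g nabla (fun q => a *: E q) A B p = a *: nabla_oneillT F g nabla E A B p.
Proof.
move=> sE sA sB; have sa := smooth_near_cst p a.
have saE := smooth_vfieldZ sa sE.
have sEA := smooth_nabla hn sE sA; have sEB := smooth_nabla hn sE sB.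
have E1 := nabla_scalel hn sa sE (smooth_oneillT sA sB).
have E2 := etrans (oneillT_ptl (smooth_nabla hn saE sA) (smooth_vfieldZ sa sEA) sB
  (nabla_scalel hn sa sE sA)) (oneillTZl sa sEA sB).
have E3 := etrans (oneillT_ptr sA (smooth_nabla hn saE sB) (smooth_vfieldZ sa sEB)
  (nabla_scalel hn sa sE sB)) (oneillTZr sa sA sEB).
have alg (x y z x' y' z' : 'rV[R]_m) : x' = a *: x -> y' = a *: y -> z' = a *: z ->
    x' - y' - z' = a *: (x - y - z) by move=> -> -> ->; rewrite !scalerBr.
exact: (alg _ _ _ _ _ _ E1 E2 E3).
Qed.

(** The derivative of [f] along [E] arises from differentiating [T] and from the differentiated
    argument of [T], with opposite signs. *)
Lemma nabla_oneillT_ptA p E A A' B : smooth_vfield_near p E -> smooth_vfield_near p A ->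
  smooth_vfield_near p A' -> smooth_vfield_near p B -> A p = A' p ->
  nabla_oneillT F g nabla E A B p = nabla_oneillT F g nabla E A' B p.
Proof.
move=> sE sA sA' sB.
apply: (tensorial (L := fun A => nabla_oneillT F g nabla E A B p)) sA sA'
  => [A1 A2 s1 s2|f A1 sf s1].
- have sT1 := smooth_oneillT s1 sB; have sT2 := smooth_oneillT s2 sB.
  have s12 := smooth_vfieldD s1 s2; have sEB := smooth_nabla hn sE sB.
  have n1 := smooth_nabla hn sE s1; have n2 := smooth_nabla hn sE s2.
  have E1 : nabla E (T (fun q => A1 q + A2 q) B) p = nabla E (T A1 B) p + nabla E (T A2 B) p.
    apply: etrans (nabla_addr hn sE sT1 sT2).
    apply: (nabla_near hn sE (smooth_oneillT s12 sB) (smooth_vfieldD sT1 sT2) _).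
    have := near_and (smooth_vfield_nbhs s1)
      (near_and (smooth_vfield_nbhs s2) (smooth_vfield_nbhs sB)).
    by apply: filterS => q [h1 [h2 h3]]; exact: (oneillTDl h1 h2 h3).
  have E2 := etrans (oneillT_ptl (smooth_nabla hn sE s12) (smooth_vfieldD n1 n2) sB
    (nabla_addr hn sE s1 s2)) (oneillTDl n1 n2 sB).
  have E3 := oneillTDl s1 s2 sEB.
  have alg (t1 t2 t3 a a' b b' c c' : 'rV[R]_m) : t1 = a + a' -> t2 = b + b' ->
      t3 = c + c' -> t1 - t2 - t3 = a - b - c + (a' - b' - c').
    by move=> -> -> ->; apply/rowP => i; rewrite !mxE; ring.
  exact: (alg _ _ _ _ _ _ _ _ _ E1 E2 E3).
- have sT1 := smooth_oneillT s1 sB.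
  have sfA := smooth_vfieldZ sf s1; have sEB := smooth_nabla hn sE sB.
  have n1 := smooth_nabla hn sE s1; have sEf := smooth_near_dirder sf sE.
  have E1 : nabla E (T (fun q => f q *: A1 q) B) p =
      dirder f p (E p) *: T A1 B p + f p *: nabla E (T A1 B) p.
    apply: etrans (nabla_leibniz hn sf sE sT1).
    apply: (nabla_near hn sE (smooth_oneillT sfA sB) (smooth_vfieldZ sf sT1) _).
    have := near_and (smooth_vfield_nbhs s1)
      (near_and (smooth_near_nbhs sf) (smooth_vfield_nbhs sB)).
    by apply: filterS => q [h1 [h2 h3]]; exact: (oneillTZl h2 h1 h3).
  have sx := smooth_vfieldZ sEf s1; have sy := smooth_vfieldZ sf n1.
  have E2 := etrans (oneillT_ptl (smooth_nabla hn sE sfA) (smooth_vfieldD sx sy) sB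
    (nabla_leibniz hn sf sE s1)) (oneillTDl sx sy sB).
  have E3 := oneillTZl sf s1 sEB.
  have alg (s t : R) (t1 t2 t3 a a' b b' b'' c : 'rV[R]_m) : t1 = t *: a + s *: a' ->
      t2 = b + b' -> b = t *: a -> b' = s *: b'' -> t3 = s *: c ->
      t1 - t2 - t3 = s *: (a' - b'' - c).
    by move=> -> -> -> -> ->; apply/rowP => i; rewrite !mxE; ring.
  exact: (alg _ _ _ _ _ _ _ _ _ _ _ E1 E2 (oneillTZl sEf s1 sB) (oneillTZl sf n1 sB) E3).
Qed.

Lemma nabla_oneillT_ptB p E A B B' : smooth_vfield_near p E -> smooth_vfield_near p A ->
  smooth_vfield_near p B -> smooth_vfield_near p B' -> B p = B' p ->
  nabla_oneillT F g nabla E A B p = nabla_oneillT F g nabla E A B' p.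
Proof.
move=> sE sA sB sB'.
apply: (tensorial (L := fun B => nabla_oneillT F g nabla E A B p)) sB sB'
  => [A1 A2 s1 s2|f A1 sf s1].
- have sT1 := smooth_oneillT sA s1; have sT2 := smooth_oneillT sA s2.
  have s12 := smooth_vfieldD s1 s2; have sEA := smooth_nabla hn sE sA.
  have n1 := smooth_nabla hn sE s1; have n2 := smooth_nabla hn sE s2.
  have E1 : nabla E (T A (fun q => A1 q + A2 q)) p = nabla E (T A A1) p + nabla E (T A A2) p.
    apply: etrans (nabla_addr hn sE sT1 sT2).
    apply: (nabla_near hn sE (smooth_oneillT sA s12) (smooth_vfieldD sT1 sT2) _).
    have := near_and (smooth_vfield_nbhs s1)
      (near_and (smooth_vfield_nbhs s2) (smooth_vfield_nbhs sA)).
    by apply: filterS => q [h1 [h2 h3]]; exact: (oneillTDr h3 h1 h2).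
  have E3 := etrans (oneillT_ptr sA (smooth_nabla hn sE s12) (smooth_vfieldD n1 n2)
    (nabla_addr hn sE s1 s2)) (oneillTDr sA n1 n2).
  have E2 := oneillTDr sEA s1 s2.
  have alg (t1 t2 t3 a a' b b' c c' : 'rV[R]_m) : t1 = a + a' -> t2 = b + b' ->
      t3 = c + c' -> t1 - t2 - t3 = a - b - c + (a' - b' - c').
    by move=> -> -> ->; apply/rowP => i; rewrite !mxE; ring.
  exact: (alg _ _ _ _ _ _ _ _ _ E1 E2 E3).
- have sT1 := smooth_oneillT sA s1.
  have sfB := smooth_vfieldZ sf s1; have sEA := smooth_nabla hn sE sA.
  have n1 := smooth_nabla hn sE s1; have sEf := smooth_near_dirder sf sE.
  have E1 : nabla E (T A (fun q => f q *: A1 q)) p =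
      dirder f p (E p) *: T A A1 p + f p *: nabla E (T A A1) p.
    apply: etrans (nabla_leibniz hn sf sE sT1).
    apply: (nabla_near hn sE (smooth_oneillT sA sfB) (smooth_vfieldZ sf sT1) _).
    have := near_and (smooth_vfield_nbhs s1)
      (near_and (smooth_near_nbhs sf) (smooth_vfield_nbhs sA)).
    by apply: filterS => q [h1 [h2 h3]]; exact: (oneillTZr h2 h3 h1).
  have sx := smooth_vfieldZ sEf s1; have sy := smooth_vfieldZ sf n1.
  have E3 := etrans (oneillT_ptr sA (smooth_nabla hn sE sfB) (smooth_vfieldD sx sy)
    (nabla_leibniz hn sf sE s1)) (oneillTDr sA sx sy).
  have E2 := oneillTZr sf sEA s1.
  have alg (s t : R) (t1 t2 t3 a a' b b' b'' c : 'rV[R]_m) : t1 = t *: a + s *: a' ->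
      t2 = s *: c -> t3 = b + b' -> b = t *: a -> b' = s *: b'' ->
      t1 - t2 - t3 = s *: (a' - c - b'').
    by move=> -> -> -> -> ->; apply/rowP => i; rewrite !mxE; ring.
  exact: (alg _ _ _ _ _ _ _ _ _ _ _ E1 E2 E3 (oneillTZr sEf sA s1) (oneillTZr sf sA n1)).
Qed.

(** The antisymmetry of O'Neill's tensor A on horizontal fields. The derivative of g(X, Y) along [V]
    is computed from metricity and from [dirder_metric_horizontal]; the comparison gives g(nabla_X
    V, Y) + g(X, nabla_Y V) = 0. *)
Lemma nabla_horizontal_skew p X Y V : smooth_vfield_near p X -> smooth_vfield_near p Y ->
  smooth_vfield_near p V -> near_horizontal p X -> near_horizontal p Y ->
  near_vertical p V -> g p (nabla X Y p) (V p) = - g p (nabla Y X p) (V p).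
Proof.
move=> sX sY sV hX hY vV.
have YV : \forall q \near p, g q (Y q) (V q) = 0.
  by have := near_and hY vV; apply: filterS => q [hYq vVq]; exact: hYq.
have XV : \forall q \near p, g q (X q) (V q) = 0.
  by have := near_and hX vV; apply: filterS => q [hXq vVq]; exact: hXq.
have E1 := nabla_perp hn sX sY sV YV; have E2 := nabla_perp hn sY sX sV XV.
have E3 := dirder_metric_horizontal hg hN hF sX sY sV hX hY vV.
have E4 := nabla_metric hn sV sX sY.
have Br (A B : vfield M) w : smooth_vfield_near p A -> smooth_vfield_near p B ->
    g p (bracket A B p) w = g p (nabla A B p) w - g p (nabla B A p) w.
  by move=> sA sB; rewrite -(metricBl hg) (nabla_torsion_free hn sA sB).
have E5 := Br _ _ (Y p) sV sX.
have E6 := etrans (metricC hg p (X p) (bracket V Y p)) (Br _ _ (X p) sV sY).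
have alg (s t d a c b1 b2 xv yv : R) : s = - yv -> t = - xv -> d = b1 + b2 ->
    d = a + c -> b1 = a - yv -> b2 = c - xv -> s = - t.
  by move=> -> -> -> h1 h2 h3; move: h1; rewrite h2 h3; lra.
have C1 := metricC hg p (Y p) (nabla X V p).
have C2 := metricC hg p (X p) (nabla Y V p).
have C3 := metricC hg p (X p) (nabla V Y p).
move: E1 E2 E3 E4 E5 E6; rewrite C1 C2 C3 => E1 E2 E3 E4 E5 E6.
exact: (alg _ _ _ _ _ _ _ _ _ E1 E2 E3 E4 E5 E6).
Qed.

(* O'Neill's formula for the curvature of the plane spanned by a horizontal X and a
   vertical V, in the case where the tensor A vanishes on that plane. *)
Lemma curvature_oneillT p X V : smooth_vfield_near p X -> smooth_vfield_near p V ->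
  near_horizontal p X -> near_vertical p V ->
  (\forall q \near p, vertical F q (nabla X V q)) ->
  g p (curvature nabla X V V p) (X p) =
  g p (nabla_oneillT F g nabla X V V p) (X p) - g p (T V X p) (T V X p).
Proof.
move=> sX sV hX vV vXV; pose x := X p.
have hx : horizontal F g p x := nbhs_singleton hX.
have vv : vertical F p (V p) := nbhs_singleton vV.
have sVV := smooth_nabla hn sV sV; have sXV := smooth_nabla hn sX sV.
have sVX := smooth_nabla hn sV sX.
pose U := app P (nabla V V); have sU : smooth_vfield_near p U := sP sVV.
pose H := app Q (nabla V X); have sH : smooth_vfield_near p H := sQ sVX.
pose K := app P (nabla V X); have sK : smooth_vfield_near p K := sP sVX.
have vU : near_vertical p U := near_vertical_vproj p _.
have vK : near_vertical p K := near_vertical_vproj p _.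
have hH : near_horizontal p H := near_horizontal_hproj p _.
have perp A B : near_vertical p A -> near_horizontal p B ->
    \forall q \near p, g q (A q) (B q) = 0.
  move=> vA hB; have := near_and vA hB; apply: filterS => q [vAq hBq].
  by rewrite (metricC hg); exact: hBq.
have gQ w : g p (Q p w) x = g p w x.
  rewrite [in RHS](vproj_hproj (F := F) (gM := g) p w) (metricDl hg) (metricC hg p (P p w)).
  by rewrite (hx _ (vertical_vproj hg hF p w)) add0r.
have XX : g p (U p) (nabla X X p) = 0.
  rewrite (metricC hg); have := nabla_horizontal_skew sX sX sU hX hX vU.
  by have alg (a : R) : a = - a -> a = 0 by [move=> E; lra]; exact: alg.
(* Near [p], nabla_V V is [T V V] plus its vertical part [U], which contributes - g(U, nabla_X X),
   zero by [XX]. *)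
have t1 : g p (nabla X (nabla V V) p) x = g p (nabla X (T V V) p) x.
  have sT := smooth_oneillT sV sV.
  have -> : nabla X (nabla V V) p = nabla X (T V V) p + nabla X U p.
    apply: etrans (nabla_addr hn sX sT sU).
    apply: (nabla_near hn sX sVV (smooth_vfieldD sT sU) _).
    have := near_and (smooth_vfield_nbhs sV) (near_near vV).
    apply: filterS => q [s1 vq]; rewrite (oneillT_vertical s1 s1 (nbhs_singleton vq) vq).
    by rewrite addrC; exact: vproj_hproj.
  by rewrite (metricDl hg) (nabla_perp hn sX sU sX (perp _ _ vU hX)) XX oppr0 addr0.
have t2 : g p (T V (nabla X V) p) x = g p (nabla V (nabla X V) p) x.
  by rewrite (oneillT_vertical sV sXV vv vXV) gQ.
have t3 : g p (T (nabla X V) V p) x = g p (nabla (nabla X V) V p) x.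
  by rewrite (oneillT_vertical sXV sV (nbhs_singleton vXV) vV) gQ.
have t4 : T V X p = K p by rewrite (oneillT_horizontal sV sX vv hX).
(* Orthogonality and antisymmetry carry the derivative over to g(H, nabla_X V), which is zero
   because nabla_X V is vertical. *)
have t5 : g p (nabla H V p) x = 0.
  rewrite /x (nabla_perp hn sH sV sX (perp _ _ vV hX)) (metricC hg).
  rewrite (nabla_horizontal_skew sH sX sV hH hX vV) opprK.
  rewrite (nabla_perp hn sX sH sV); last first.
    by have := perp _ _ vV hH; apply: filterS => q; rewrite (metricC hg).
  by rewrite (nbhs_singleton hH _ (nbhs_singleton vXV)) oppr0.
(* The origin of the term |T_V X|^2: [K] is T_V X at [p], and exchanging [K] and [V] costs only a
   vertical bracket. *)
have t6 : g p (nabla K V p) x = - g p (K p) (K p).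
  have vB : vertical F p (bracket K V p) := bracket_vertical sF sK sV vK vV.
  have -> : nabla K V p = nabla V K p + bracket K V p.
    by rewrite -(nabla_torsion_free hn sK sV) addrC subrK.
  rewrite (metricDl hg) (metricC hg p (bracket K V p)) (hx _ vB) addr0.
  rewrite (nabla_perp hn sV sK sX (perp _ _ vK hX)); congr (- _).
  rewrite (vproj_hproj (F := F) (gM := g) p (nabla V X p)) (metricDr hg) -/(K p).
  rewrite (metricC hg p _ (Q p _)).
  by rewrite (nbhs_singleton hH _ (nbhs_singleton vK)) addr0.
(* By torsion freeness [X, V] = nabla_X V - nabla_V X, and nabla_V X is split into its parts [K] and
   [H]. *)
have t7 : nabla (bracket X V) V p = nabla (nabla X V) V p - (nabla K V p + nabla H V p).
  have sKH := smooth_vfieldD sK sH.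
  apply: (etrans (nabla_pt hn (smooth_vfield_bracket sX sV) (smooth_vfieldB sXV sKH) sV _)).
    rewrite -(nabla_torsion_free hn sX sV); congr (_ - _); exact: vproj_hproj.
  apply: (etrans (nablaBl hn sXV sKH sV)); congr (_ - _).
  exact: (nabla_addl hn sK sH sV).
have alg (a b c k h t : 'rV[R]_m) (s : R) : t = c - (k + h) ->
    g p h x = 0 -> g p k x = - s -> g p (a - b - t) x = g p a x - g p b x - g p c x - s.
  move=> -> h0 ks; rewrite !(metricBl hg) !(metricDl hg) h0 ks; ring.
apply: (etrans (alg _ _ _ _ _ _ _ t7 t5 t6)).
rewrite t1 -t2 -t3 t4.
have alg2 (a b c : 'rV[R]_m) (s : R) :
    g p a x - g p b x - g p c x - s = g p (a - c - b) x - s.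
  by rewrite !(metricBl hg); ring.
exact: alg2.
Qed.

End ONeill.

(** * Submersions of cosymplectic manifolds *)

Section CosymplecticSubmersion.
Context {R : realType} {m n : nat} {M : manifold R m} {N : manifold R n}.
Context {phi : endo_field M} {xi : vfield M} {eta : covector_field M}.
Context {g : bilinear_form M} {nabla : covariant_derivative M}.
Context {gN : bilinear_form N} {F : M -> N}.
Hypothesis hc : cosymplectic phi xi eta g.
Hypothesis hn : levi_civita g nabla.
Hypothesis hN : riemannian_metric gN.
Hypothesis hF : riemannian_submersion F g gN.
Hypothesis hdec : horizontal_decomposition F g phi xi.
Implicit Types (p q : M) (u v w : 'rV[R]_m) (X Y Z V : vfield M).

Let acm : almost_contact_metric phi xi eta g := cosymplectic_acm hc.
Let hg : riemannian_metric g := acm_metric acm.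
Let sF : smooth_map F := submersion_smooth hF.

Local Notation P := (vproj F g).
Local Notation Q := (hproj F g).
Local Notation T := (oneillT F g nabla).
Local Notation near_vertical p V := (\forall q \near p, vertical F q (V q)).
Local Notation near_horizontal p X := (\forall q \near p, horizontal F g q (X q)).

Lemma horizontal_phi p w : vertical F p w -> horizontal F g p (phi p w).
Proof. by move=> vw; apply/(hdec p).1; exists w, 0; rewrite scale0r addr0. Qed.

Lemma horizontal_xi p : horizontal F g p (xi p).
Proof.
apply/(hdec p).1; exists 0, 1; split; first exact: (vertical0 sF).
by rewrite (phi0 hc) scale1r add0r.
Qed.

Lemma eta_vertical p w : vertical F p w -> eta p w = 0.
Proof. by move=> vw; rewrite (acm_eta_dual acm) (metricC hg); exact: (horizontal_xi vw). Qed.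

Lemma etaD p u v : eta p (u + v) = eta p u + eta p v.
Proof. by rewrite !(acm_eta_dual acm) (metricDl hg). Qed.

Lemma phi_phi p u : eta p u = 0 -> phi p (phi p u) = - u.
Proof. by move=> u0; rewrite (acm_phi2 acm) u0 scale0r addr0. Qed.

(** By the decomposition [x] is phi w + a xi with [w] vertical, and a = eta x = 0; hence phi x = phi
    (phi w) = - w. *)
Lemma vertical_phi p x : horizontal F g p x -> eta p x = 0 -> vertical F p (phi p x).
Proof.
move=> /(hdec p).1 [w [a [vw ->]]].
rewrite etaD (acm_eta_phi acm) add0r (acm_eta_dual acm) (metricZl hg).
rewrite (metric_xi hc) mulr1 => ->; rewrite scale0r addr0.
rewrite (phi_phi (eta_vertical vw)); exact: (verticalN sF).
Qed.

Lemma eta_hproj p z : eta p z = 0 -> eta p (Q p z) = 0.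
Proof.
rewrite [in X in X -> _](vproj_hproj (F := F) (gM := g) p z) etaD.
by rewrite (eta_vertical (vertical_vproj hg hF p z)) add0r.
Qed.

(** [phi] sends the horizontal part of [z] to a vector that is vertical and, by difference,
    horizontal, hence zero; and [phi] is injective where [eta] vanishes. *)
Lemma vertical_of_phi p z : horizontal F g p (phi p z) -> eta p z = 0 -> vertical F p z.
Proof.
move=> hz ez; have eQ := eta_hproj ez.
have vP := vertical_vproj hg hF p z; have hQ := horizontal_hproj hg hF p z.
have h1 : horizontal F g p (phi p (Q p z)).
  have -> : phi p (Q p z) = phi p z - phi p (P p z) by rewrite -(phiB hc).
  exact: (horizontalB hg hz (horizontal_phi vP)).
have p0 := vertical_horizontal0 hg (vertical_phi hQ eQ) h1.
have Q0 : Q p z = 0.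
  by apply: oppr_inj; rewrite oppr0 -(phi_phi eQ) p0 (phi0 hc).
by rewrite (vproj_hproj (F := F) (gM := g) p z) Q0 addr0.
Qed.

Lemma eta_nabla_vertical p X V : smooth_vfield_near p X -> smooth_vfield_near p V ->
  near_vertical p V -> eta p (nabla X V p) = 0.
Proof.
move=> sX sV vV; rewrite (eta_nabla hc hn sX sV).
rewrite (dirder_near (g := fun=> 0 : R^o)) ?dirder_cst //.
by apply: filterS vV => q; exact: eta_vertical.
Qed.

Section VerticalField.
Variables (p : M) (V : vfield M).
Hypotheses (sV : smooth_vfield_near p V) (vV : near_vertical p V).
Let sphi : smooth_vfield_near p (app phi V) := smooth_phi hc sV.

Lemma near_horizontal_phi : near_horizontal p (app phi V).
Proof. by apply: filterS vV => q; exact: horizontal_phi. Qed.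

Lemma nabla_phi_vertical : vertical F p (nabla (app phi V) V p).
Proof.
apply: vertical_of_phi; last exact: (eta_nabla_vertical sphi sV vV).
rewrite -(nabla_phi hc hn sphi sV) => w vw.
have [W sW Wp] := vfield_through p w.
have hX := near_horizontal_phi.
have sPW := smooth_vproj hg hF sW.
have := nabla_horizontal_skew hg hN hn hF sphi sphi sPW hX hX (near_vertical_vproj hg hF p W).
rewrite [app P W p](_ : _ = w); last by rewrite /app Wp; exact: (vproj_vertical hg hF vw).
have alg (a : R) : a = - a -> a = 0 by move=> E; lra.
exact: alg.
Qed.

(** nabla_V (phi V) is phi of nabla_V V, and [phi] exchanges vertical and horizontal parts here
    because [eta] vanishes on the horizontal part of nabla_V V. *)
Lemma oneillT_phi : T V (app phi V) p = phi p (T V V p).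
Proof.
have vVp : vertical F p (V p) := nbhs_singleton vV.
have hX := near_horizontal_phi.
rewrite (oneillT_horizontal hg hn hF sV sphi vVp hX).
rewrite (oneillT_vertical hg hn hF sV sV vVp vV) (nabla_phi hc hn sV sV).
have eQ := eta_hproj (eta_nabla_vertical sV sV vV).
have hQ := horizontal_hproj hg hF p (nabla V V p).
rewrite [in LHS](vproj_hproj (F := F) (gM := g) p (nabla V V p)) (phiD hc).
rewrite (vprojD hg hF) (vproj_vertical hg hF (vertical_phi hQ eQ)).
have hP := horizontal_phi (vertical_vproj hg hF p (nabla V V p)).
by rewrite (vproj_horizontal hg hF hP) add0r.
Qed.

Lemma norm_oneillT_phi :
  g p (T V (app phi V) p) (T V (app phi V) p) = g p (T V V p) (T V V p).
Proof.
have vVp : vertical F p (V p) := nbhs_singleton vV.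
rewrite oneillT_phi (acm_compatible acm).
rewrite (oneillT_vertical hg hn hF sV sV vVp vV).
by rewrite (eta_hproj (eta_nabla_vertical sV sV vV)) mulr0 subr0.
Qed.

End VerticalField.

Lemma curvature_phi_vertical p V : smooth_vfield_near p V -> near_vertical p V ->
  g p (curvature nabla (app phi V) V V p) (phi p (V p)) =
  g p (nabla_oneillT F g nabla (app phi V) V V p) (phi p (V p)) -
  g p (T V (app phi V) p) (T V (app phi V) p).
Proof.
move=> sV vV; have sX := smooth_phi hc sV.
apply: (curvature_oneillT hg hN hn hF sX sV (near_horizontal_phi vV) vV).
have := near_and (smooth_vfield_nbhs sV) (near_near vV).
by apply: filterS => q [sVq vVq]; exact: nabla_phi_vertical.
Qed.

Lemma curvature_phi p A B Z : smooth_vfield_near p A -> smooth_vfield_near p B ->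
  smooth_vfield_near p Z ->
  curvature nabla A B (app phi Z) p = phi p (curvature nabla A B Z p).
Proof.
move=> sA sB sZ.
have H (C D : vfield M) : smooth_vfield_near p C -> smooth_vfield_near p D ->
    nabla C (nabla D (app phi Z)) p = phi p (nabla C (nabla D Z) p).
  move=> sC sD; have sDZ := smooth_nabla hn sD sZ; have sphi := smooth_phi hc sZ.
  apply: etrans (nabla_phi hc hn sC sDZ).
  apply: (nabla_near hn sC (smooth_nabla hn sD sphi) (smooth_phi hc sDZ)).
  have := near_and (smooth_vfield_nbhs sD) (smooth_vfield_nbhs sZ).
  by apply: filterS => q [h1 h2]; exact: (nabla_phi hc hn h1 h2).
have alg (a b c a' b' c' : 'rV[R]_m) : a' = phi p a -> b' = phi p b -> c' = phi p c ->
    a' - b' - c' = phi p (a - b - c) by move=> -> -> ->; rewrite !(phiB hc).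
exact: (alg _ _ _ _ _ _ (H _ _ sA sB) (H _ _ sB sA)
  (nabla_phi hc hn (smooth_vfield_bracket sA sB) sZ)).
Qed.

Lemma phi_sectional_vertical p V : smooth_vfield_near p V -> vertical F p (V p) ->
  phi_sectional phi g nabla V p =
  g p (nabla_oneillT F g nabla (app phi V) V V p) (phi p (V p)) -
  g p (T V V p) (T V V p).
Proof.
move=> sV vVp; pose W := app P V.
have sW : smooth_vfield_near p W := smooth_vproj hg hF sV.
have vW : near_vertical p W := near_vertical_vproj hg hF p V.
have VW : V p = W p by rewrite /W /app (vproj_vertical hg hF vVp).
have sX := smooth_phi hc sV; have sY := smooth_phi hc sW.
have XY : app phi V p = app phi W p by rewrite /app VW.
(* One [phi] is taken out of the curvature and moved by skewness to the other factor; the sign is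
   absorbed by exchanging the first two arguments of the curvature. *)
have -> : phi_sectional phi g nabla V p = g p (curvature nabla (app phi W) W W p) (phi p (W p)).
  rewrite /phi_sectional (curvature_pt hn sV sW sX sY sX sY VW XY XY) VW.
  rewrite (curvature_phi sW sY sW) (phi_skew hc).
  by rewrite (curvatureC hn sW sY sW) (metricNl hg) opprK.
rewrite (curvature_phi_vertical sW vW) (norm_oneillT_phi sW vW) VW.
rewrite (nabla_oneillT_ptE hg hn hF sX sY sV sV XY).
rewrite (nabla_oneillT_ptA hg hn hF sY sV sW sV VW).
rewrite (nabla_oneillT_ptB hg hn hF sY sW sV sW VW).
by rewrite (oneillT_ptl hg hn hF sV sW sV VW) (oneillT_ptr hg hn hF sW sV sW VW).
Qed.

Lemma phi_sectional_horizontal p X : smooth_vfield_near p X -> horizontal F g p (X p) ->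
  g p (X p) (xi p) = 0 ->
  phi_sectional phi g nabla X p =
  g p (nabla_oneillT F g nabla X (app phi X) (app phi X) p) (X p) -
  g p (T (app phi X) X p) (T (app phi X) X p).
Proof.
move=> sX hX Xxi; have eX : eta p (X p) = 0 by rewrite (acm_eta_dual acm).
pose Y := app phi X; have sY : smooth_vfield_near p Y := smooth_phi hc sX.
pose W := app P Y; have sW : smooth_vfield_near p W := smooth_vproj hg hF sY.
have vW : near_vertical p W := near_vertical_vproj hg hF p Y.
have YW : Y p = W p by rewrite /W /app (vproj_vertical hg hF (vertical_phi hX eX)).
have sZ : smooth_vfield_near p (app phi W) := smooth_phi hc sW.
(* At [p] the vertical field [W] is phi X, so phi W is - X there. The sign enters each term of the
   formula for [W] twice. *)
pose A : vfield M := fun q => (-1 : R) *: app phi W q.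
have s1 := smooth_near_cst p (-1 : R).
have sA : smooth_vfield_near p A := smooth_vfieldZ s1 sZ.
have XA : X p = A p.
  by rewrite /A /app -YW /Y /app (phi_phi eX) scaleN1r opprK.
have E1 := etrans (curvature_pt hn sX sA sY sW sY sW XA YW YW)
  (curvatureZl hn s1 sZ sW sW).
have E2 := etrans (etrans (etrans (nabla_oneillT_ptE hg hn hF sX sA sY sY XA)
  (nabla_oneillT_ptA hg hn hF sA sY sW sY YW))
  (nabla_oneillT_ptB hg hn hF sA sW sY sW YW)) (nabla_oneillTZ hg hn hF (-1) sZ sW sW).
have E3 := etrans (etrans (oneillT_ptl hg hn hF sY sW sX YW)
  (oneillT_ptr hg hn hF sW sX sA XA)) (oneillTZr hg hn hF s1 sW sZ).
have K := curvature_phi_vertical sW vW.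
have XA' : X p = (-1 : R) *: phi p (W p) by exact: XA.
have alg (c d t c' d' t' x w : 'rV[R]_m) : c' = (-1 : R) *: c -> d' = (-1 : R) *: d ->
    t' = (-1 : R) *: t -> x = (-1 : R) *: w -> g p c w = g p d w - g p t t ->
    g p c' x = g p d' x - g p t' t'.
  move=> -> -> -> -> E; rewrite !(metricZl hg) !(metricZr hg) E; ring.
exact: (alg _ _ _ _ _ _ _ _ E1 E2 E3 XA' K).
Qed.

End CosymplecticSubmersion.

Theorem theorem18 (R : realType) (m n : nat) (M : manifold R m) (N : manifold R n)
    (phi : endo_field M) (xi : vfield M) (eta : covector_field M)
    (gM : bilinear_form M) (nabla : covariant_derivative M)
    (gN : bilinear_form N) (F : M -> N)
    (hM : cosymplectic phi xi eta gM)
    (hnabla : levi_civita gM nabla)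
    (hN : riemannian_metric gN)
    (hF : riemannian_submersion F gM gN)
    (hdec : horizontal_decomposition F gM phi xi) :
  (forall (p : M) (V : vfield M), smooth_vfield_near p V ->
     vertical F p (V p) -> gM p (V p) (V p) = 1 ->
     phi_sectional phi gM nabla V p
     = gM p (nabla_oneillT F gM nabla (app phi V) V V p) (phi p (V p))
       - gM p (oneillT F gM nabla V V p) (oneillT F gM nabla V V p)) /\
  (forall (p : M) (X : vfield M), smooth_vfield_near p X ->
     horizontal F gM p (X p) -> gM p (X p) (X p) = 1 -> gM p (X p) (xi p) = 0 ->
     phi_sectional phi gM nabla X p
     = gM p (nabla_oneillT F gM nabla X (app phi X) (app phi X) p) (X p)
       - gM p (oneillT F gM nabla (app phi X) X p)
              (oneillT F gM nabla (app phi X) X p)).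
Proof.
split=> [p V sV vV _|p X sX hX _ Xxi].
  exact: (phi_sectional_vertical hM hnabla hN hF hdec sV vV).
exact: (phi_sectional_horizontal hM hnabla hN hF hdec sX hX Xxi).
Qed.
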